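(* Suppose that $\Delta_n\to\Delta\in[0,1]$ and $\lambda_n\to\lambda\in[0,1]$, and let $\beta>0$ be a constant. Then $\mathcal F_{G_n,\beta}\to\mathcal F_{\lambda,\Delta}(\beta)$ in probability, where $\mathcal F_{\lambda,\Delta}$ is a continuous function of $\beta$ given by: (A) if $\Delta=1$, then $\lambda=0$ and $\mathcal F_{\lambda,\Delta}(\beta)=-1/\beta$; (B) if $\Delta\in[0,1)$ and $\lambda\in[0,1)$, then $\mathcal F_{\lambda,\Delta}(\beta)=-\frac{\lambda+\Delta}{\beta}$ for $\beta\ge1-\Delta$, and $\mathcal F_{\lambda,\Delta}(\beta)=\frac{1-(\lambda+\Delta)}{1-\Delta}-\frac1\beta$ for $\beta\le1-\Delta$; (C) if $\lambda=1$, then $\Delta=0$ and $\mathcal F_{\lambda,\Delta}(\beta)=-1/\beta$.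
   Context: Let $(\alpha_n)$ be a sequence in $(0,\infty)$ with $0<\liminf\alpha_n\le\limsup\alpha_n<\infty$, $q_n=\alpha_n\log n/n$, $G_n\sim\mathcal G(n,q_n)$ on $\{1,\dots,n\}$. Let $\ell_n^*=\log n/\log(nq_n)$, $d_n^*=\min\{d\in\mathbb Z:(nq_n)^d\ge n/(\log\log n)^2\}$, $\Delta_n=d_n^*-\ell_n^*$, and $\lambda_n\in(0,1)$ with $\log(1/\lambda_n)=(nq_n)^{d_n^*}/n$. Let $\overline G_n$ be the connected component of $G_n$ containing vertex $1$, with vertex set $\overline V_n$. For spanning trees $T$ of $\overline G_n$ let $\mathsf d_T(1,v)$ be the tree distance. Define $Z_{G_n,\beta}=\sum_T\exp\big(-\beta\log\log(n)\sum_{v\in\overline V_n}\mathsf d_T(1,v)\big)$ over spanning trees $T$ of $\overline G_n$, $E_{G_n}=\sum_{v\in\overline V_n}\mathsf d_{G_n}(1,v)$, and the relative free energy density $\mathcal F_{G_n,\beta}=\frac1n\big(-\frac{1}{\beta\log\log n}\log Z_{G_n,\beta}-E_{G_n}\big)$. *)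

(* Defs.v *)
From HB Require Import structures.
From mathcomp Require Import all_boot all_order all_algebra.
From mathcomp Require Import all_classical all_reals all_analysis.

Set Implicit Arguments.
Unset Strict Implicit.
Unset Printing Implicit Defensive.

Import Order.TTheory GRing.Theory Num.Theory.
Import numFieldNormedType.Exports.

Local Open Scope classical_set_scope.
Local Open Scope ring_scope.

Section Graphs.
Variable V : finType.

(* A simple graph on V is represented by its edge set E, a subset of
   [vpairs]; loops are excluded since [set x; x] has one element. *)
Definition vpairs : {set {set V}} := [set e : {set V} | #|e| == 2]%SET.

Definition adj (E : {set {set V}}) : rel V :=
  [rel x y | [set x; y]%SET \in E].

(* Number of edges of a shortest walk from x to y (#|V| if there is none). *)
Definition gdist (e : rel V) (x y : V) : nat :=
  find (fun k => [exists p : k.-tuple V, path e x p && (last x p == y)])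
       (iota 0 #|V|).

Definition comp_verts (E : {set {set V}}) (r : V) : {set V} :=
  [set v | connect (adj E) r v]%SET.

Definition comp_edges (E : {set {set V}}) (r : V) : {set {set V}} :=
  [set e in E | e \subset comp_verts E r]%SET.

Definition acyclic (F : {set {set V}}) : Prop :=
  forall c : seq V, (2 < size c)%N -> ~ ucycle (adj F) c.

(* F is the edge set of a tree with vertex set W. *)
Definition is_tree (W : {set V}) (F : {set {set V}}) : Prop :=
  [/\ forall e, e \in F -> e \subset W,
      {in W &, forall u v, connect (adj F) u v} &
      acyclic F].

(* Spanning trees (as edge sets) of the component of r. *)
Definition spanning_trees (E : {set {set V}}) (r : V) : {set {set {set V}}} :=
  [set F : {set {set V}} | (F \subset comp_edges E r)
                           && `[< is_tree (comp_verts E r) F >]]%SET.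

Definition total_dist (E F : {set {set V}}) (r : V) : nat :=
  (\sum_(v in comp_verts E r) gdist (adj F) r v)%N.

End Graphs.

(* Probability of the event A for the Erdos-Renyi graph on V in which each pair
   is an edge independently with probability q, meaningful for 0 <= q <= 1. *)
Definition gnp_prob (R : realType) (V : finType) (q : R)
    (A : pred {set {set V}}) : R :=
  \sum_(E in powerset (vpairs V) | A E)
    q ^+ #|E| * (1 - q) ^+ #|(vpairs V :\: E)%SET|.

Section Scaling.
Variables (R : realType) (alpha : nat -> R).

Definition loglog (n : nat) : R := ln (ln n%:R).

(* With alpha bounded, 0 <= edge_prob n <= 1 for all large n. *)
Definition edge_prob (n : nat) : R := alpha n * ln n%:R / n%:R.

Definition mean_deg (n : nat) : R := n%:R * edge_prob n.

Definition ell_star (n : nat) : R := ln n%:R / ln (mean_deg n).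

(* The least element of the set; it exists as soon as mean_deg n > 1
   and n > 2, see [d_star_min]. The value 0 is used if there is none. *)
Definition d_star_set (n : nat) : set int :=
  [set d : int | mean_deg n ^ d >= n%:R / loglog n ^+ 2].

Definition d_star (n : nat) : int :=
  xget 0 (d_star_set n `&` lbound (d_star_set n)).

Definition Delta_seq (n : nat) : R := (d_star n)%:~R - ell_star n.

(* The solution of ln (1 / lambda) = mean_deg n ^ d_star n / n,
   see [lambda_seqP]. *)
Definition lambda_seq (n : nat) : R := expR (- (mean_deg n ^ d_star n / n%:R)).

End Scaling.

Section FreeEnergy.
Variables (R : realType) (n : nat).
(* Graphs on n.+1 vertices; the root, vertex 1 of {1, ..., n.+1}, is ord0. *)
Variable E : {set {set 'I_n.+1}}.

Definition partition_fun (beta : R) : R :=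
  \sum_(F in spanning_trees E ord0)
    expR (- (beta * loglog R n.+1 * (total_dist E F ord0)%:R)).

Definition ground_energy : R := (total_dist E E ord0)%:R.

Definition free_energy (beta : R) : R :=
  n.+1%:R^-1 *
  (- ((beta * loglog R n.+1)^-1 * ln (partition_fun beta)) - ground_energy).

End FreeEnergy.

Lemma least_int_expz (R : realType) (x b : R) : 1 < x -> 0 < b ->
  let D := [set d : int | b <= x ^ d] in exists d, (D `&` lbound D) d.
Proof.
move=> x1 b0 D.
have big c : exists N : nat, c < x ^+ N.
  have y0 : 0 < x - 1 by rewrite subr_gt0.
  exists (Num.truncn (c / (x - 1))).+1; set N := _.+1.
  have h : c < N%:R * (x - 1).
    by rewrite -ltr_pdivrMr//; exact: truncnS_gt.
  apply: lt_le_trans h _; elim: N => [|N IH]; first by rewrite mul0r expr0.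
  rewrite exprS -natr1 mulrDl mul1r -[X in _ <= X * _](subrK 1) mulrDl mul1r addrC.
  by apply: lerD => //; apply: ler_peMr; [exact: ltW|apply: exprn_ege1; exact: ltW].
have [M hM] := big b; have [N hN] := big b^-1.
have x0 : 0 < x := lt_trans ltr01 x1.
pose P k := b <= x ^ (k%:Z - N%:Z).
have exP : exists k, P k.
  by exists (M + N)%N; rewrite /P PoszD addrK /exprz ltW.
have [k Pk kmin] := ex_minnP exP.
exists (k%:Z - N%:Z); split=> // d /= Dd.
have Nd : - N%:Z <= d.
  rewrite leNgt; apply/negP => dN.
  have : x ^ d < x ^ (- N%:Z) by rewrite ltr_eXz2l.
  rewrite -invr_expz => h; have := le_lt_trans Dd h.
  rewrite ltNge => /negP; apply.
  by rewrite -[leRHS]invrK lef_pV2 ?posrE ?invr_gt0 ?exprz_gt0 ?ltW.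
have dN0 : 0 <= d + N%:Z by rewrite -lerBlDr sub0r.
have := kmin (absz (d + N%:Z)); rewrite /P gez0_abs// addrK => /(_ Dd).
by rewrite -lez_nat gez0_abs// lerBlDr.
Qed.

Lemma d_star_min (R : realType) (alpha : nat -> R) (n : nat) :
  1 < mean_deg alpha n -> 0 < n%:R / loglog R n ^+ 2 ->
  d_star_set alpha n (d_star alpha n) /\
  lbound (d_star_set alpha n) (d_star alpha n).
Proof. by move=> x1 b0; exact: xgetPex (least_int_expz x1 b0). Qed.

Lemma lambda_seqP (R : realType) (alpha : nat -> R) (n : nat) :
  (0 < n)%N -> 0 < mean_deg alpha n ->
  0 < lambda_seq alpha n < 1 /\
  ln (1 / lambda_seq alpha n) = mean_deg alpha n ^ d_star alpha n / n%:R.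
Proof.
move=> n0 m0; split; last by rewrite /lambda_seq div1r -expRN opprK expRK.
by rewrite expR_gt0/= expR_lt1 oppr_lt0 divr_gt0 ?exprz_gt0 ?ltr0n.
Qed.

(* Main.v *)
(** Idea. Write L = log log n, m = n q and E_G for the sum of the distances to the
    root in G, so that the free energy is - ln (Z e^(beta L E_G)) / (beta L n).
    Sending a tree to its parent map gives
      Z e^(beta L E_G) <= prod_v (a_v + deg_v e^(- beta L)),
    where a_v counts the neighbours of v that are closer to the root, and any
    choice of parents of smaller level gives a tree, whence lower bounds.
    With d = d_n^*, the layers up to d - 1 have o(n) vertices, layer d has about
    (1 - lambda) n vertices with a_v about m^Delta, and almost all other vertices
    are in layer d + 1 with a_v about m. So a vertex of layer d contributes
    max (Delta, 1 - beta) L, the second option being to hang it below another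
    vertex of layer d, and one of layer d + 1 contributes L; hence
      F (beta) = - (lambda + (1 - lambda) max (Delta, 1 - beta)) / beta.
    The layer sizes are controlled by first and second moments along the
    breadth-first exploration, and the degrees into a given layer by a union
    bound over all pairs of vertex sets. *)

Require Import Defs.
From HB Require Import structures.
From mathcomp Require Import all_boot all_order all_algebra.
From mathcomp Require Import all_classical all_reals all_analysis.
From mathcomp Require Import zify ring lra.
(* Again, so that subsetP, setUC, ... refer to finite sets. *)
From mathcomp Require Import fintype finset.

Set Implicit Arguments.
Unset Strict Implicit.
Unset Printing Implicit Defensive.

Import Order.TTheory GRing.Theory Num.Theory.
Import numFieldNormedType.Exports.

Local Open Scope ring_scope.

(** * Distances and trees *)

Section GraphDistance.
Variable V : finType.
Implicit Types (e : rel V) (E F : {set {set V}}).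

(** The upper bound runs on totals only: replacing ln by its tangent at one of two well chosen
    points leaves the number of edges and the number of pairs (vertex, closer neighbour), whose
    means suffice, so no single degree is bounded from above. The lower bounds need almost all
    degrees into a set. In one of them this is a small part S of layer d picked after the graph is
    known, whence a union bound over all sets instead of an estimate conditional on the exploration.
    S has at most eta n vertices, so that they are negligible themselves, and at least n / (8 L^2),
    so that the degrees into it still have logarithm close to L. Either lambda or Delta vanishes,
    and this is why three lower bounds are enough: up to the factor n L they are Delta, lambda and 1
    - beta (1 - lambda), with parents in layer d - 1, in layer d and in S. In either case lambda +
    (1 - lambda) max (Delta, 1 - beta) is the larger of two of them. All losses are powers of L
    inside logarithms of order L, or fractions eta of the vertices, with eta fixed before n. *)

Lemma gdist_le_size e x p : path e x p -> (gdist e x (last x p) <= size p)%N.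
Proof.
move=> xp; rewrite leqNgt; apply/negP => lt.
have szV : (size p < #|V|)%N.
  by apply: leq_trans lt _; rewrite -[leqRHS](size_iota 0); exact: find_size.
have := before_find 0%N lt; rewrite nth_iota// add0n => /negbT/negP; apply.
by apply/existsP; exists (in_tuple p); rewrite /= xp eqxx.
Qed.

(** A walk without repeated vertices has fewer than [#|V|] edges, hence lies in the range that
    [gdist] searches. *)
Lemma gdist_path e x y : connect e x y ->
  exists p, [/\ path e x p, last x p = y & size p = gdist e x y].
Proof.
move=> /connectP[p0 /shortenP[p xp up _] ->].
set a := (fun k => [exists p0 : k.-tuple V, path e x p0 && (last x p0 == last x p)]).
have hasa : has a (iota 0 #|V|).
  apply/hasP; exists (size p).
    rewrite mem_iota/= add0n.
    by have := max_card (mem (x :: p)); rewrite (card_uniqP up).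
  by apply/existsP; exists (in_tuple p); rewrite /= xp eqxx.
have := nth_find 0%N hasa; rewrite nth_iota ?add0n; last first.
  by rewrite -[ltnRHS](size_iota 0) -has_find.
move=> /existsP[t /andP[xt /eqP lt]].
by exists t; split => //; rewrite size_tuple.
Qed.

Lemma gdist_refl e x : gdist e x x = 0%N.
Proof. by apply/eqP; rewrite -leqn0; exact: (@gdist_le_size e x [::]). Qed.

Lemma gdist_eq0 e x y : connect e x y -> gdist e x y = 0%N -> y = x.
Proof. by move=> /gdist_path[p [_ <- <-]] /size0nil ->. Qed.

Lemma gdist_step e x u v : connect e x u -> e u v ->
  (gdist e x v <= (gdist e x u).+1)%N.
Proof.
move=> /gdist_path[p [xp lp <-]] uv.
have -> : v = last x (rcons p v) by rewrite last_rcons.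
by rewrite -(size_rcons p v); apply: gdist_le_size; rewrite rcons_path xp lp.
Qed.

Lemma gdist_pred e x v : connect e x v -> v != x ->
  exists u, [/\ connect e x u, e u v & (gdist e x u).+1 = gdist e x v].
Proof.
move=> xv; have [p [xp lp sz]] := gdist_path xv.
case/lastP: p xp lp sz => [|p w]; first by move=> _ /= -> _; rewrite eqxx.
rewrite last_rcons rcons_path size_rcons => /andP[xp uv] wv sz _.
rewrite wv in uv; exists (last x p).
have cu : connect e x (last x p) by apply/connectP; exists p.
split=> //; apply/eqP; rewrite eqn_leq; apply/andP; split.
  by rewrite -sz ltnS; exact: gdist_le_size.
exact: gdist_step.
Qed.

Lemma gdist_sub e e' x v : subrel e e' -> connect e x v ->
  (gdist e' x v <= gdist e x v)%N.
Proof.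
move=> ee' /gdist_path[p [xp <- <-]]; apply: gdist_le_size.
exact: sub_path xp.
Qed.

Lemma adj_sym E : symmetric (adj E).
Proof. by move=> x y; rewrite /adj/= setUC. Qed.

Lemma adj_subset E F : F \subset E -> subrel (adj F) (adj E).
Proof. by move=> /subsetP sFE x y /sFE. Qed.

(** A simple path from u to v that avoids the edge closes up with it to a cycle. The cycle has more
    than two vertices, since u and v differ and the path is not the deleted edge. *)
Lemma acyclic_edgeP F u v : acyclic F -> u != v -> adj F u v ->
  ~ connect (adj (F :\ [set u; v])) u v.
Proof.
move=> acF uv Fuv /connectP[p0 /shortenP[p up uq _] lp].
have sub : subrel (adj (F :\ [set u; v])) (adj F).
  by apply: adj_subset; exact: subsetDl.
case: p up uq lp => [|w [|w' p]] up uq lp.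
- by rewrite lp/= eqxx in uv.
- by move: up; rewrite /= in lp; rewrite /= -lp /adj/= !inE eqxx.
apply: (acF [:: u, w, w' & p]) => //; apply/andP; split=> //.
rewrite /cycle rcons_path (sub_path sub up) -lp adj_sym.
exact: Fuv.
Qed.

(** If uv were not a parent edge, the parent chains would still join u and v to r after its
    deletion, against [acyclic_edgeP]. This is what makes a tree recoverable from its parent map. *)
Lemma is_tree_edgeP (W : {set V}) F r (p : V -> V) u v :
  r \in W -> is_tree W F ->
  {in W :\ r, forall w, adj F (p w) w /\
     (gdist (adj F) r (p w)).+1 = gdist (adj F) r w} ->
  u != v -> adj F u v -> v != r /\ p v = u \/ u != r /\ p u = v.
Proof.
move=> rW [FW Fc Fa] pP uv Fuv; apply: contrapT => /not_orP[n1 n2].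
apply: (acyclic_edgeP Fa uv Fuv).
have toroot x : x \in W -> connect (adj (F :\ [set u; v])) r x.
  move: {2}(gdist (adj F) r x) (erefl (gdist (adj F) r x)) => k.
  elim: k x => [|k IH] x dx xW; have rx := Fc _ _ rW xW.
    by rewrite (gdist_eq0 rx dx) connect0.
  have xr : x != r by apply/eqP => xr; rewrite xr gdist_refl in dx.
  have [yx dy] : adj F (p x) x /\ (gdist (adj F) r (p x)).+1 = gdist (adj F) r x.
    by apply: pP; rewrite in_setD1 xr.
  have yW : p x \in W.
    by have /subsetP := FW _ yx; apply; rewrite !inE eqxx.
  apply: connect_trans (IH (p x) _ yW) (connect1 _).
    by rewrite dx in dy; case: dy.
  rewrite /adj/= in_setD1 [_ \in F]yx andbT; apply/eqP => e.
  have : p x \in [set u; v] by rewrite -e !inE eqxx.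
  have : x \in [set u; v] by rewrite -e !inE eqxx orbT.
  rewrite !inE => /orP[]/eqP ex /orP[]/eqP ey.
  - by move: dy; rewrite ex in ey *; rewrite ey; lia.
  - by apply: n2; rewrite -ex.
  - by apply: n1; rewrite -ex.
  - by move: dy; rewrite ex in ey *; rewrite ey; lia.
have uW : u \in W by have /subsetP := FW _ Fuv; apply; rewrite !inE eqxx.
have vW : v \in W.
  by have /subsetP := FW _ Fuv; apply; rewrite !inE eqxx orbT.
have symc : connect_sym (adj (F :\ [set u; v])).
  by apply: sym_connect_sym; exact: adj_sym.
by apply: connect_trans (toroot v vW); rewrite symc; exact: toroot.
Qed.

End GraphDistance.

(** * Spanning trees and parent maps *)

Section TreeSums.
Variables (V : finType) (R : realType) (E : {set {set V}}) (r : V).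
Hypothesis simpleE : E \subset vpairs V.
Local Notation C := (comp_verts E r).

Lemma root_in_comp : r \in C. Proof. by rewrite inE connect0. Qed.

Lemma comp_adj u v : u \in C -> adj E u v -> v \in C.
Proof. by rewrite !inE => ru uv; apply: connect_trans ru (connect1 uv). Qed.

Lemma spanning_treesP F : F \in spanning_trees E r ->
  [/\ F \subset E, forall e, e \in F -> e \subset C & is_tree C F].
Proof.
rewrite inE => /andP[/subsetP sF /asboolP FT]; split=> //.
  by apply/subsetP => e /sF; rewrite inE => /andP[].
by move=> e /sF; rewrite inE => /andP[].
Qed.

Lemma total_dist_root F :
  total_dist E F r = (\sum_(v in C :\ r) gdist (adj F) r v)%N.
Proof.
rewrite /total_dist (bigD1 r) ?root_in_comp//= gdist_refl add0n.
by apply: eq_bigl => v; rewrite in_setD1 andbC.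
Qed.

(** The value r outside [C :\ r] puts the map into the family of functions with default r over which
    a product of sums expands. *)
Let tree_parent (F : {set {set V}}) : {ffun V -> V} :=
  [ffun v => if v \in C :\ r then
     odflt r [pick u | adj F u v && ((gdist (adj F) r u).+1 == gdist (adj F) r v)]
   else r].

Let tree_parentP F : F \in spanning_trees E r ->
  {in C :\ r, forall v, adj F (tree_parent F v) v /\
    (gdist (adj F) r (tree_parent F v)).+1 = gdist (adj F) r v}.
Proof.
move=> /spanning_treesP[_ _ [_ Fc _]] v vC; rewrite ffunE vC.
case: pickP => [u /andP[uv /eqP du]//|none].
have [vr vC'] := setD1P vC.
have [u [_ uv du]] := gdist_pred (Fc _ _ root_in_comp vC') vr.
by have := none u; rewrite uv du eqxx.
Qed.

(** By [is_tree_edgeP] a tree is the set of its parent edges. *)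
Let tree_parent_inj : {in spanning_trees E r &, injective tree_parent}.
Proof.
have recover F : F \in spanning_trees E r ->
    F = [set [set v; tree_parent F v] | v in C :\ r].
  move=> FT; have pP := tree_parentP FT.
  have [FE FC FT'] := spanning_treesP FT.
  apply/setP => e; apply/idP/imsetP; last first.
    by move=> [v /pP[vp _] ->]; rewrite setUC.
  move=> eF.
  have : e \in vpairs V by apply: (subsetP simpleE); exact: (subsetP FE).
  rewrite inE => /cards2P[x [y [xy exy]]].
  have Fxy : adj F x y by rewrite /adj/= -exy.
  have xC : x \in C by have /subsetP := FC _ eF; apply; rewrite exy !inE eqxx.
  have yC : y \in C.
    by have /subsetP := FC _ eF; apply; rewrite exy !inE eqxx orbT.
  have [[yr py]|[xr px]] := is_tree_edgeP root_in_comp FT' pP xy Fxy.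
    by exists y; rewrite ?in_setD1 ?yr// py setUC.
  by exists x; rewrite ?in_setD1 ?xr// px.
by move=> F F' FT FT' e; rewrite [LHS]recover// [RHS]recover// e.
Qed.

(** The tree distance of v is one more than that of its parent, which is at least the graph distance
    of the parent. So the weight of a tree is at most a product of factors depending on one parent
    each, and enlarging the sum from parent maps of trees to all maps along edges makes it
    factorize. *)
Lemma sum_spanning_trees_le (b : R) : 0 <= b ->
  \sum_(F in spanning_trees E r) expR (- (b * (total_dist E F r)%:R)) <=
  \prod_(v in C :\ r) \sum_(u | adj E u v)
     expR (- (b * (gdist (adj E) r u).+1%:R)).
Proof.
move=> b0; rewrite (big_distr_big_dep r)/=.
set h := fun f : {ffun V -> V} =>
  \prod_(v in C :\ r) expR (- (b * (gdist (adj E) r (f v)).+1%:R)).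
have h0 f : 0 <= h f by apply: prodr_ge0 => v _; exact: expR_ge0.
apply: (@le_trans _ _ (\sum_(F in spanning_trees E r) h (tree_parent F))).
  apply: ler_sum => F FT; have pP := tree_parentP FT.
  have [FE FC [_ Fc _]] := spanning_treesP FT.
  rewrite total_dist_root natr_sum mulr_sumr -sumrN expR_sum.
  apply: ler_prod => v vC; rewrite expR_ge0/= ler_expR lerN2.
  have [uv <-] := pP v vC; rewrite ler_wpM2l// ler_nat ltnS.
  apply: gdist_sub; first exact: adj_subset.
  by apply: Fc; [exact: root_in_comp|have /subsetP := FC _ uv; apply; rewrite !inE eqxx].
rewrite -(big_imset h tree_parent_inj)/=.
rewrite [leRHS](bigID (mem [set tree_parent x | x in spanning_trees E r]))/=.
rewrite -[leLHS]addr0; apply: lerD; last by apply: sumr_ge0 => f _; exact: h0.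
rewrite le_eqVlt; apply/orP; left; apply/eqP; apply: eq_bigl => f.
apply/idP/andP => [fT|[]//]; split=> //.
have {fT}/imsetP[F FT ->] := fT; apply/pfamilyP; split.
  apply/subsetP => v; rewrite inE ffunE.
  by case: ifP => [vC _ //|_]; rewrite eqxx.
move=> v vC; have [uv _] := tree_parentP FT vC.
by have [FE _ _] := spanning_treesP FT; exact: adj_subset uv.
Qed.

Section LevelTrees.
Variables (lev : V -> nat) (Par : V -> {set V}).
Hypothesis ParP : {in C :\ r, forall v u, u \in Par v ->
  [/\ u \in C, adj E u v & (lev u < lev v)%N]}.

Let level_tree (f : {ffun V -> V}) := [set [set v; f v] | v in C :\ r].

Let level_choice := pfamily r (mem (C :\ r)) (fun v => mem (Par v)).

Let choiceP (f : {ffun V -> V}) : f \in level_choice ->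
  {in C :\ r, forall v, [/\ f v \in C, adj E (f v) v & (lev (f v) < lev v)%N]}.
Proof. by move=> /pfamilyP[_ fP] v vC; apply: ParP => //; exact: fP. Qed.

Let level_tree_adj f x y : adj (level_tree f) x y ->
  (x \in C :\ r /\ f x = y) \/ (y \in C :\ r /\ f y = x) \/ x = y.
Proof.
move=> /imsetP[v vC /setP e].
have := e x; have := e y; rewrite !in_set2 !eqxx ?orbT/=.
move=> /esym/orP[]/eqP yE /esym/orP[]/eqP xE; rewrite xE yE.
- by right; right.
- by right; left; split.
- by left; split.
- by right; right.
Qed.

Let level_tree_mem f v : v \in C :\ r -> adj (level_tree f) (f v) v.
Proof. by move=> vC; rewrite adj_sym; apply/imsetP; exists v. Qed.

Let level_tree_dist f : f \in level_choice ->
  {in C, forall v, connect (adj (level_tree f)) r v /\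
     (gdist (adj (level_tree f)) r v <= lev v)%N}.
Proof.
move=> fc v; have [k] := ubnP (lev v); elim: k v => // k IH v lk vC.
have [->|vr] := eqVneq v r; first by rewrite connect0 gdist_refl.
have vC' : v \in C :\ r by rewrite in_setD1 vr.
have [uC uv luv] := choiceP fc vC'.
have [cu du] := IH (f v) (leq_trans luv lk) uC.
have a := level_tree_mem f vC'; split.
  exact: connect_trans cu (connect1 a).
by apply: leq_trans (gdist_step cu a) _; exact: leq_ltn_trans luv.
Qed.

Let level_tree_spanning f : f \in level_choice ->
  level_tree f \in spanning_trees E r.
Proof.
move=> fc; have symT : connect_sym (adj (level_tree f)).
  by apply: sym_connect_sym; exact: adj_sym.
have sub e : e \in level_tree f -> e \in E /\ e \subset C.
  move=> /imsetP[v vC ->]; have [uC uv _] := choiceP fc vC.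
  split; first by rewrite setUC.
  apply/subsetP => w; rewrite !inE => /orP[]/eqP ->.
    by have := subsetP (subsetDl C [set r]) _ vC; rewrite inE.
  by move: uC; rewrite inE.
rewrite inE; apply/andP; split.
  by apply/subsetP => e /sub[eE eC]; rewrite inE eE eC.
apply/asboolP; split.
- by move=> e /sub[].
- move=> u v uC vC; have [cu _] := level_tree_dist fc uC.
  have [cv _] := level_tree_dist fc vC.
  by apply: connect_trans cv; rewrite symT.
(* Both neighbours on the cycle of a vertex x of maximal level would have to be its unique parent
   [f x]. *)
- move=> c c2 uc.
  have [x0 x0c] : exists x, x \in c by case: c c2 {uc} => // x; exists x; rewrite inE eqxx.
  have [x xc xmax] := @arg_maxnP V x0 (mem c) lev x0c.
  have [i c' rotc] := rot_to xc.
  have := rot_ucycle i (adj (level_tree f)) c; rewrite rotc => uc'.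
  rewrite -uc' in uc.
  have mem' y : y \in x :: c' -> y \in c by rewrite -rotc mem_rot.
  have sz : (2 < size (x :: c'))%N by rewrite -rotc size_rot.
  have up y : y \in c -> y != x -> adj (level_tree f) x y -> f x = y.
    move=> yc yx /level_tree_adj[[]//|[[yC fy]|xy]]; last by rewrite xy eqxx in yx.
    by have [_ _] := choiceP fc yC; rewrite fy ltnNge => /negP[]; exact: xmax.
  case: c' sz rotc uc' uc mem' => [|y c'] //; case/lastP: c' => [//|c' z].
  move=> _ _ _ /andP[]; rewrite /cycle /= => /andP[xy].
  rewrite rcons_path last_rcons => /andP[_ zx].
  rewrite !inE !mem_rcons !inE => /and3P[/norP[xny /norP[xnz _]] yz _] mem'.
  have fy : f x = y.
    by apply: up => //; [apply: mem'; rewrite !inE eqxx orbT|rewrite eq_sym].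
  have fz : f x = z.
    apply: up; [|by rewrite eq_sym|by rewrite adj_sym].
    by apply: mem'; rewrite !inE mem_rcons inE eqxx !orbT.
  by rewrite -fy fz eqxx in yz.
Qed.

(** An edge from v to [f v] that is not the parent edge of v for g would be that of [f v], so the
    level would decrease from v to [f v] and back. *)
Let level_tree_inj : {in level_choice &, injective level_tree}.
Proof.
move=> f g fc gc fg; apply/ffunP => v; have [vC|vC] := boolP (v \in C :\ r).
  have [_ fvv lf] := choiceP fc vC.
  have : adj (level_tree g) (f v) v by rewrite -fg; exact: level_tree_mem.
  move=> /level_tree_adj[[fC gf]|[[]//|fv]].
    have [_ _] := choiceP gc fC; rewrite gf => lg.
    by have := ltn_trans lf lg; rewrite ltnn.
  by rewrite fv ltnn in lf.
have out (h : {ffun V -> V}) : h \in level_choice -> h v = r.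
  move=> /pfamilyP[/subsetP sh _]; apply/eqP; apply: contraNT vC => hv.
  by apply: sh; rewrite inE.
by rewrite !out.
Qed.

(** The product counts the choices of parents; distinct choices give distinct trees, with distances
    at most [lev]. Levels may exceed graph distances, which leaves room for trees that are not
    breadth-first. *)
Lemma sum_spanning_trees_ge (b : R) : 0 <= b ->
  expR (- (b * (\sum_(v in C) lev v)%:R)) * \prod_(v in C :\ r) #|Par v|%:R <=
  \sum_(F in spanning_trees E r) expR (- (b * (total_dist E F r)%:R)).
Proof.
move=> b0.
have -> : \prod_(v in C :\ r) #|Par v|%:R = \sum_(f in level_choice) (1 : R).
  under eq_bigr do rewrite -sum1_card natr_sum.
  rewrite (big_distr_big_dep r)/=.
  by apply: eq_bigr => f _; rewrite big1.
rewrite mulr_sumr.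
set g := fun F => expR (- (b * (total_dist E F r)%:R)).
apply: (@le_trans _ _ (\sum_(f in level_choice) g (level_tree f))).
  apply: ler_sum => f fc; rewrite mulr1 ler_expR lerN2 ler_wpM2l// ler_nat.
  by apply: leq_sum => v vC; have [] := level_tree_dist fc vC.
rewrite -(big_imset g level_tree_inj)/=.
rewrite [leRHS](bigID (mem [set level_tree f | f in level_choice]))/=.
rewrite -[leLHS]addr0; apply: lerD; last by apply: sumr_ge0 => f _; exact: expR_ge0.
rewrite le_eqVlt; apply/orP; left; apply/eqP; apply: eq_bigl => F; apply/idP/andP => [FT|[]//]; split=> //.
by have {FT}/imsetP[f fc ->] := FT; exact: level_tree_spanning.
Qed.

End LevelTrees.
End TreeSums.

(** * Layers and bounds on the partition function *)

Section Layers.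
Variable V : finType.
Implicit Types (E F K : {set {set V}}) (r u v : V).

Definition layer E r k : {set V} :=
  [set v in comp_verts E r | gdist (adj E) r v == k].

Definition inner E r k : {set V} :=
  [set v in comp_verts E r | gdist (adj E) r v < k]%N.

Lemma layer0 E r : layer E r 0 = [set r].
Proof.
apply/setP => v; rewrite !inE; apply/andP/eqP => [[rv /eqP dv]|->].
  exact: gdist_eq0 dv.
by rewrite connect0 gdist_refl.
Qed.

Lemma inner0 E r : inner E r 0 = set0.
Proof. by apply/setP => v; rewrite !inE ltn0 andbF. Qed.

Lemma innerS E r k : inner E r k.+1 = inner E r k :|: layer E r k.
Proof.
by apply/setP => v; rewrite !inE ltnS leq_eqVlt orbC andb_orr.
Qed.

Lemma card_innerS E r k : #|inner E r k.+1| = (#|inner E r k| + #|layer E r k|)%N.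
Proof.
rewrite innerS cardsU; set X := _ :&: _; suff -> : X = set0.
  by rewrite cards0 subn0.
apply/setP => v; rewrite !inE; case: (connect _ _ _) => //=.
by case: ltngtP.
Qed.

Lemma card_inner E r k : #|inner E r k| = (\sum_(j < k) #|layer E r j|)%N.
Proof.
elim: k => [|k IH]; first by rewrite inner0 cards0 big_ord0.
by rewrite card_innerS big_ord_recr/= IH.
Qed.

Lemma in_layerS E r k v : (v \in layer E r k.+1) =
  (v \notin inner E r k.+1) && [exists u in layer E r k, adj E u v].
Proof.
apply/idP/andP => [|[nv /existsP[u /andP[]]]].
  rewrite !inE => /andP[rv /eqP dv].
  rewrite rv dv ltnn/=; split=> //.
  have vr : v != r by apply/eqP => vr; rewrite vr gdist_refl in dv.
  have [u [ru uv du]] := gdist_pred rv vr; apply/existsP; exists u.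
  by rewrite !inE ru uv andbT/=; rewrite dv in du; case: du => ->.
rewrite !inE in nv * => /andP[ru /eqP du] uv.
have rv : connect (adj E) r v by apply: connect_trans ru (connect1 uv).
rewrite rv/= -leqNgt in nv *; rewrite eqn_leq nv andbT -du.
exact: gdist_step.
Qed.

(** Exploring the layers up to k only queries pairs that meet [inner E r k], so changes elsewhere
    are not seen. *)
Lemma layer_agree E E' r k :
  (forall (e : {set V}) x, x \in inner E r k -> x \in e -> (e \in E) = (e \in E')) ->
  inner E' r k = inner E r k /\ layer E' r k = layer E r k.
Proof.
elim: k => [|k IH] EE'; first by rewrite !inner0 !layer0.
have [i1 l1] : inner E' r k = inner E r k /\ layer E' r k = layer E r k.
  apply: IH => e x xi xe; apply: (EE' e x) => //.
  by rewrite innerS inE xi.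
have iS : inner E' r k.+1 = inner E r k.+1 by rewrite !innerS i1 l1.
split=> //; apply/setP => v; rewrite !in_layerS iS l1; congr (_ && _).
apply: eq_existsb => u; case: (boolP (u \in layer E r k)) => //= ul.
rewrite /adj/= (EE' _ u)// ?in_set2 ?eqxx//.
by rewrite innerS inE ul orbT.
Qed.

(** The form in which locality feeds [expect_indep]: the event that the exploration is in state (A,
    D) does not depend on pairs avoiding A. *)
Lemma layer_setD E K r k (A D : {set V}) :
  (forall e : {set V}, e \in K -> [disjoint e & A]) ->
  ((inner (E :\: K) r k == A) && (layer (E :\: K) r k == D)) =
  ((inner E r k == A) && (layer E r k == D)).
Proof.
move=> KA.
have aux (e : {set V}) x : x \in A -> x \in e -> (e \in E) = (e \in E :\: K).
  move=> xA xe; rewrite !inE; case: (boolP (e \in K)) => //= eK.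
  by have /pred0P/(_ x) := KA e eK; rewrite /= xA xe.
apply/andP/andP => [[/eqP iA /eqP lD]|[/eqP iA /eqP lD]].
  have [|-> ->] := @layer_agree (E :\: K) E r k; last by rewrite iA lD !eqxx.
  by move=> e x; rewrite iA => xA xe; rewrite (aux e x).
have [|-> ->] := @layer_agree E (E :\: K) r k; last by rewrite iA lD !eqxx.
by move=> e x; rewrite iA; exact: aux.
Qed.

Definition nbrs E (S : {set V}) v : {set V} := [set u in S | adj E u v].

Definition bfs_parents E r v : {set V} :=
  [set u | adj E u v & (gdist (adj E) r u).+1 == gdist (adj E) r v].

Definition degree_sum E : nat := (\sum_v #|nbrs E setT v|)%N.

Definition parent_sum E r k : nat :=
  (\sum_(v in inner E r k :\ r) #|bfs_parents E r v|)%N.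

End Layers.

Lemma prod_expR_ln (R : realType) (I : finType) (P : pred I) (f : I -> R) :
  (forall i, P i -> 0 < f i) ->
  \prod_(i | P i) f i = expR (\sum_(i | P i) ln (f i)).
Proof.
by move=> f0; rewrite expR_sum; apply: eq_bigr => i Pi; rewrite lnK// posrE f0.
Qed.

(** The tangent of ln at t, without its term -1. It turns a sum of logarithms into a sum of the
    arguments. *)
Lemma ln_le_div (R : realType) (x t : R) : 0 < x -> 0 < t ->
  ln x <= ln t + x / t.
Proof.
move=> x0 t0; have xt : 0 < x / t by rewrite divr_gt0.
rewrite -lerBlDl -ln_div ?posrE//.
have : ln (1 + (x / t - 1)) <= x / t - 1 by apply: le_ln1Dx; lra.
by rewrite [1 + _]addrC subrK; lra.
Qed.

(** * Entropy against energy in the partition function *)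

Section LogPartition.
Variables (V : finType) (R : realType) (E : {set {set V}}) (r : V) (b : R).
Hypotheses (simpleE : E \subset vpairs V) (b0 : 0 <= b).
Local Notation C := (comp_verts E r).
Local Notation d := (gdist (adj E) r).

Definition log_excess : R :=
  ln (\sum_(F in spanning_trees E r) expR (- (b * (total_dist E F r)%:R))) +
  b * (total_dist E E r)%:R.

Lemma bfs_parentsP v u : v \in C -> u \in bfs_parents E r v ->
  [/\ u \in C, adj E u v & (d u).+1 = d v].
Proof.
rewrite !inE => rv /andP[uv /eqP du]; split=> //.
by apply: connect_trans rv (connect1 _); rewrite adj_sym.
Qed.

Lemma bfs_parents_gt0 v : v \in C :\ r -> (0 < #|bfs_parents E r v|)%N.
Proof.
rewrite !inE => /andP[vr rv]; have [u [_ uv du]] := gdist_pred rv vr.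
by apply/card_gt0P; exists u; rewrite inE uv du eqxx.
Qed.

Lemma bfs_parents_levels : {in C :\ r, forall v u, u \in bfs_parents E r v ->
  [/\ u \in C, adj E u v & (d u < d v)%N]}.
Proof.
move=> v /setD1P[_ vC] u /(bfs_parentsP vC)[uC uv <-].
by split.
Qed.

(** The sum of logarithms is the entropy of the parent choices; the term with b is the energy paid
    for levels above the graph distances. *)
Lemma log_excess_ge_levels (lev : V -> nat) (Par : V -> {set V}) :
  {in C :\ r, forall v u, u \in Par v ->
    [/\ u \in C, adj E u v & (lev u < lev v)%N]} ->
  {in C :\ r, forall v, (0 < #|Par v|)%N} ->
  \sum_(v in C :\ r) ln #|Par v|%:R
    - b * ((\sum_(v in C) lev v)%:R - (total_dist E E r)%:R) <= log_excess.
Proof.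
move=> ParP Par0; have := sum_spanning_trees_ge ParP b0.
rewrite prod_expR_ln; last by move=> v vC; rewrite ltr0n Par0.
rewrite -expRD /log_excess => le.
have : - (b * (\sum_(v in C) lev v)%:R) + \sum_(v in C :\ r) ln #|Par v|%:R <=
    ln (\sum_(F in spanning_trees E r) expR (- (b * (total_dist E F r)%:R))).
  rewrite -ler_expR lnK// posrE; apply: lt_le_trans le; exact: expR_gt0.
by lra.
Qed.

Lemma vertex_weight_gt0 v : v \in C :\ r ->
  0 < #|bfs_parents E r v|%:R + #|nbrs E setT v|%:R * expR (- b).
Proof.
move=> /bfs_parents_gt0; rewrite -(ltr0n R) => a0.
have : 0 <= #|nbrs E setT v|%:R * expR (- b) by rewrite mulr_ge0// expR_ge0.
by lra.
Qed.

(** A neighbour u of v has [d u + 1 >= d v]. With equality u is a breadth-first parent and has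
    weight 1 after multiplication by e^(b d(v)); otherwise at least one unit is lost and the weight
    is at most e^(-b). *)
Lemma log_excess_le :
  log_excess <= \sum_(v in C :\ r)
    ln (#|bfs_parents E r v|%:R + #|nbrs E setT v|%:R * expR (- b)).
Proof.
pose Z := \sum_(F in spanning_trees E r) expR (- (b * (total_dist E F r)%:R)).
have Z0 : 0 < Z.
  apply: lt_le_trans (sum_spanning_trees_ge bfs_parents_levels b0).
  rewrite mulr_gt0 ?expR_gt0// prodr_gt0// => v vC.
  by rewrite ltr0n bfs_parents_gt0.
rewrite -ler_expR expRD lnK ?posrE//.
rewrite -prod_expR_ln; last first.
  exact: vertex_weight_gt0.
apply: (@le_trans _ _ ((\prod_(v in C :\ r) \sum_(u | adj E u v)
     expR (- (b * (d u).+1%:R))) * \prod_(v in C :\ r) expR (b * (d v)%:R))).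
  rewrite total_dist_root natr_sum mulr_sumr -expR_sum.
  by apply: ler_wpM2r; [exact: expR_ge0|exact: sum_spanning_trees_le].
rewrite -big_split/=; apply: ler_prod => v vC; apply/andP; split.
  rewrite mulr_ge0 ?expR_ge0// sumr_ge0// => u _; exact: expR_ge0.
have vC' : v \in C by exact: (subsetP (subsetDl _ _) _ vC).
rewrite mulr_suml (bigID (fun u => u \in bfs_parents E r v))/=; apply: lerD.
  apply: (@le_trans _ _ (\sum_(u in bfs_parents E r v) 1)); last first.
    by rewrite sumr_const.
  rewrite le_eqVlt; apply/orP; left; apply/eqP.
  apply: eq_big => [u|u /andP[_]]; first by rewrite inE; case: (adj E u v).
  move=> /(bfs_parentsP vC')[_ _ <-].
  by rewrite -expRD addNr expR0.
rewrite -sum1_card natr_sum mulr_suml big_mkcond [leRHS]big_mkcond/=.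
apply: ler_sum => u _; rewrite !inE; case: (boolP (adj E u v)) => //= uv.
case: ifP => [du|_]; last by rewrite mul1r expR_ge0.
rewrite mul1r -expRD ler_expR.
have uC : connect (adj E) r u.
  by move: vC'; rewrite inE => rv; apply: connect_trans rv (connect1 _); rewrite adj_sym.
have := gdist_step uC uv; rewrite leq_eqVlt eq_sym (negbTE du)/= ltnS.
rewrite -(ler_nat R) -subr_ge0 => /(mulr_ge0 b0).
by rewrite -natr1; lra.
Qed.

(** Tangent at t1 for the vertices at distance less than k and at t2 for the others, where e^(-b) <=
    1 and twice the degree bounds the weight crudely. Only totals over all vertices remain. *)
Lemma log_excess_le_split k (t1 t2 : R) : 1 <= t1 -> 1 <= t2 ->
  log_excess <= #|inner E r k|%:R * ln t1
    + (#|V|%:R - #|inner E r k|%:R) * ln t2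
    + ((parent_sum E r k)%:R + (degree_sum E)%:R * expR (- b)) / t1
    + 2 * (degree_sum E)%:R / t2.
Proof.
move=> t11 t21; have [p1 p2] : 0 < t1 /\ 0 < t2 by lra.
have [l1 l2] : 0 <= ln t1 /\ 0 <= ln t2 by rewrite !ln_ge0.
apply: le_trans log_excess_le _.
pose w v : R := #|bfs_parents E r v|%:R + #|nbrs E setT v|%:R * expR (- b).
have w0 v : v \in C :\ r -> 0 < w v.
  exact: vertex_weight_gt0.
rewrite (bigID (mem (inner E r k)))/=.
have subI : inner E r k :\ r \subset C.
  by apply: subset_trans (subsetDl _ _) _; apply/subsetP => v; rewrite !inE => /andP[].
have IE : forall v, (v \in C :\ r) && (v \in inner E r k) = (v \in inner E r k :\ r).
  move=> v; rewrite !in_setD1; case: eqP => //= _.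
  by case: (boolP (v \in inner E r k)) => [|_]; rewrite ?andbF// !inE => /andP[->].
set I := inner E r k.
have degE : (degree_sum E)%:R = \sum_v (#|nbrs E setT v|%:R : R) by rewrite natr_sum.
apply: (@le_trans _ _ ((#|I|%:R * ln t1 +
      ((parent_sum E r k)%:R + (degree_sum E)%:R * expR (- b)) / t1) +
    ((#|V|%:R - #|I|%:R) * ln t2 + 2 * (degree_sum E)%:R / t2))); last by lra.
apply: lerD.
  rewrite (eq_bigl _ _ IE).
  apply: (@le_trans _ _ (\sum_(v in I :\ r) (ln t1 + w v / t1))).
    apply: ler_sum => v vI; apply: ln_le_div => //; apply: w0.
    by have := IE v; rewrite vI => /andP[].
  rewrite big_split/= sumr_const -[ln t1 *+ _]mulr_natl; apply: lerD.
    by rewrite ler_wpM2r// ler_nat subset_leq_card// subsetDl.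
  rewrite -mulr_suml ler_wpM2r ?invr_ge0 ?(ltW p1)//.
  rewrite big_split/= -natr_sum lerD2l -mulr_suml ler_wpM2r ?expR_ge0// degE.
  by rewrite [leRHS](bigID (mem (I :\ r)))/= lerDl sumr_ge0.
apply: (@le_trans _ _ (\sum_(v in ~: I) (ln t2 + 2 * #|nbrs E setT v|%:R / t2))).
  rewrite [leRHS](bigID (mem (C :\ r)))/= -[leLHS]addr0; apply: lerD; last first.
    apply: sumr_ge0 => v _; rewrite addr_ge0// divr_ge0 ?mulr_ge0//.
    exact: ltW.
  rewrite [leRHS](eq_bigl (fun v => (v \in C :\ r) && (v \notin I))); last first.
    by move=> v; rewrite [v \in ~: I]inE andbC.
  apply: ler_sum => v /andP[vC _].
  apply: le_trans (ln_le_div (w0 v vC) p2) _.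
  rewrite lerD2l ler_wpM2r ?invr_ge0 ?(ltW p2)//.
  rewrite mulrDl mul1r lerD//.
    rewrite ler_nat subset_leq_card//; apply/subsetP => u.
    by rewrite !inE => /andP[->].
  by rewrite ler_piMr// expR_le1 oppr_le0.
rewrite big_split/= sumr_const -[ln t2 *+ _]mulr_natl -mulr_suml -mulr_sumr; apply: lerD.
  by rewrite cardsCs finset.setCK natrB ?max_card.
rewrite ler_wpM2r ?invr_ge0 ?(ltW p2)// ler_wpM2l// degE.
by rewrite [leRHS](bigID (mem (~: I)))/= lerDl sumr_ge0.
Qed.

Definition low_degree (S : {set V}) (t : R) : {set V} :=
  [set v | (v \notin S) && (#|nbrs E S v|%:R <= t)].

Lemma sum_ln_ge (A : {set V}) (f : V -> nat) (t : R) (X : nat) : 1 <= t ->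
  (#|V| <= #|A| + X)%N -> A \subset C :\ r ->
  {in C :\ r, forall v, (0 < f v)%N} -> {in A, forall v, t <= (f v)%:R} ->
  (#|V|%:R - X%:R) * ln t <= \sum_(v in C :\ r) ln (f v)%:R.
Proof.
move=> t1 VA AC f0 At; have l0 : 0 <= ln t by exact: ln_ge0.
apply: (@le_trans _ _ (#|A|%:R * ln t)).
  by rewrite ler_wpM2r// lerBlDr -natrD ler_nat.
rewrite [leRHS](bigID (mem A))/= -[leLHS]addr0; apply: lerD; last first.
  by apply: sumr_ge0 => v /andP[vC _]; rewrite ln_ge0// ler1n f0.
rewrite mulr_natl -sumr_const.
rewrite [leRHS](eq_bigl (mem A)); last first.
  by move=> v; apply/andP/idP => [[]//|vA]; split=> //; exact: (subsetP AC).
apply: ler_sum => v vA; have tv := At v vA.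
by rewrite -ler_expR !lnK ?posrE//; lra.
Qed.

(** A vertex outside [inner E r k.+1] with a neighbour in layer k lies in layer k + 1, and all its
    neighbours in layer k are its parents. So almost every vertex has t parents as soon as both
    exceptional sets are small. *)
Lemma log_excess_ge_bfs k (t : R) : 1 <= t ->
  (#|V|%:R - (#|inner E r k.+1| + #|low_degree (layer E r k) t|)%:R) * ln t
    <= log_excess.
Proof.
move=> t1.
have := log_excess_ge_levels bfs_parents_levels bfs_parents_gt0.
rewrite subrr mulr0 subr0; apply: le_trans.
pose S := layer E r k.
pose A := ~: (inner E r k.+1 :|: low_degree S t).
have nA v : v \in A -> v \notin inner E r k.+1 /\ t < #|nbrs E S v|%:R.
  rewrite inE in_setU => /norP[vi]; rewrite inE negb_and negbK -ltNge.
  have -> /= : (v \in S) = false.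
    by apply/negP => vS; case/negP: vi; rewrite innerS in_setU vS orbT.
  by [].
have AL v : v \in A -> v \in layer E r k.+1.
  move=> /nA[vi tv]; rewrite in_layerS vi/=.
  have : (0 < #|nbrs E S v|)%N by rewrite -(ltr0n R); lra.
  by move=> /card_gt0P[u]; rewrite inE => ?; apply/existsP; exists u.
apply: (@sum_ln_ge A) => //.
- rewrite -(cardsC (inner E r k.+1 :|: low_degree S t)) addnC leq_add2l.
  exact: leq_card_setU.
- apply/subsetP => v vA; have := AL v vA; rewrite !inE => /andP[-> /eqP dv].
  by rewrite andbT; apply/eqP => vr; rewrite vr gdist_refl in dv.
- exact: bfs_parents_gt0.
- move=> v vA; have [_ tv] := nA v vA; apply: le_trans (ltW tv) _.
  have := AL v vA; rewrite inE => /andP[_ /eqP dv].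
  rewrite ler_nat subset_leq_card//; apply/subsetP => u.
  by rewrite !inE dv => /andP[/andP[_ /eqP ->] ->]; rewrite eqxx.
Qed.

(* Trees in which almost every vertex beyond level k hangs directly below S. *)
Lemma log_excess_ge_shift k (S : {set V}) (t : R) : 1 <= t ->
  S \subset layer E r k.+1 ->
  (#|V|%:R - (#|inner E r k.+1| + #|S| + #|low_degree S t|)%:R) * ln t
   - b * (#|layer E r k.+1| + #|low_degree S t|)%:R <= log_excess.
Proof.
move=> t1 SL.
pose I := inner E r k.+1; pose L := low_degree S t.
have SI v : v \in S -> v \in C /\ d v = k.+1.
  by move=> /(subsetP SL); rewrite inE => /andP[vC /eqP].
have dI v : v \in C -> (v \in I) = (d v <= k)%N by rewrite !inE => ->; rewrite ltnS.
(* A vertex with a neighbour in S goes just below S, which has level k + 1. The remaining vertices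
   keep their breadth-first parents; beyond layer k + 1 such a parent may itself have been raised by
   one, hence the level d + 1. *)
pose lev v := if v \in I :|: S then d v else
  if nbrs E S v != set0 then k.+2 else if v \in layer E r k.+1 then d v else (d v).+1.
pose Par v := if v \in I :|: S then bfs_parents E r v else
  if nbrs E S v != set0 then nbrs E S v else bfs_parents E r v.
have ndI v : v \in C -> v \notin I :|: S -> (k < d v)%N.
  by move=> vC; rewrite in_setU dI// => /norP[]; rewrite -ltnNge.
have lev_le v : v \in C -> (lev v <= (d v).+1)%N.
  move=> vC; rewrite /lev; case: ifPn => // vIS; have := ndI v vC vIS.
  by case: ifP => // _; case: ifP.
have lev_eq v : v \in C -> (d v <= k)%N -> lev v = d v.
  by move=> vC dv; rewrite /lev in_setU dI// dv.
have ParP : {in C :\ r, forall v u, u \in Par v ->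
    [/\ u \in C, adj E u v & (lev u < lev v)%N]}.
  move=> v vC u; have vC' : v \in C by exact: (subsetP (subsetDl _ _) _ vC).
  rewrite /Par {2}/lev; case: ifPn => vIS.
    move=> /(bfs_parentsP vC')[uC uv du]; split=> //.
    rewrite lev_eq ?du// -ltnS du.
    by move: vIS; rewrite in_setU dI// => /orP[|/SI[_ ->]//]; lia.
  case: ifPn => [_|_].
    rewrite inE => /andP[uS uv]; have [uC du] := SI u uS; split=> //.
    by rewrite /lev in_setU uS orbT du.
  move=> /(bfs_parentsP vC')[uC uv du]; split=> //.
  case: ifP => [|_]; last by rewrite ltnS -du; exact: lev_le.
  by rewrite inE => /andP[_ /eqP dv]; rewrite lev_eq; lia.
have Par0 : {in C :\ r, forall v, (0 < #|Par v|)%N}.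
  move=> v vC; rewrite /Par; case: ifP => _; first exact: bfs_parents_gt0.
  by case: ifP => [|_]; [rewrite card_gt0|exact: bfs_parents_gt0].
have := log_excess_ge_levels ParP Par0; apply: le_trans; apply: lerB.
  pose A := ~: (I :|: S :|: L).
  have nA v : v \in A -> v \notin I :|: S /\ t < #|nbrs E S v|%:R.
    rewrite inE in_setU => /norP[vIS]; rewrite inE negb_and negbK -ltNge.
    have -> /= : (v \in S) = false; last by [].
    by apply/negP => vS; case/negP: vIS; rewrite in_setU vS orbT.
  have n0 v : v \in A -> nbrs E S v != set0.
    by move=> /nA[_ tv]; rewrite -card_gt0 -(ltr0n R); lra.
  apply: (@sum_ln_ge A) => //.
  - rewrite -(cardsC (I :|: S :|: L)) addnC leq_add2l.
    by apply: leq_trans (leq_card_setU _ _) _; rewrite leq_add2r leq_card_setU.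
  - apply/subsetP => v vA; have [vIS _] := nA v vA.
    have /set0Pn[u] := n0 v vA; rewrite inE => /andP[uS uv].
    have [uC _] := SI u uS; rewrite in_setD1 (comp_adj uC uv) andbT.
    apply: contraNneq vIS => ->; rewrite in_setU (dI _ (root_in_comp E r)).
    by rewrite gdist_refl.
  - move=> v vA; have [vIS tv] := nA v vA.
    by rewrite /Par (negbTE vIS) n0// ltW.
rewrite ler_wpM2l// lerBlDr -natrD ler_nat /total_dist.
rewrite -[#|layer _ _ _|]sum1_card -[#|low_degree _ _|]sum1_card.
(* Levels exceed distances by at most one, and only in layer k + 1 or at a vertex without neighbour
   in S, which then belongs to L: a vertex below S and outside layer k + 1 has distance at least k +
   2 already. *)
apply: (@leq_trans (\sum_(v in C) ((v \in layer E r k.+1) + (v \in L) + d v))).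
  apply: leq_sum => v vC; rewrite /lev; case: ifPn => [|vIS]; first by lia.
  have dv := ndI v vC vIS.
  have Lay : (v \in layer E r k.+1) = (d v == k.+1) by move: vC; rewrite !inE => ->.
  case: ifPn => [|n0]; first by rewrite Lay; case: eqP; lia.
  rewrite Lay; case: eqP => [_|_]; first by lia.
  have -> : v \in L; last by lia.
  rewrite inE; move: vIS; rewrite in_setU => /norP[_ ->]/=.
  by rewrite negbK in n0; rewrite (eqP n0) cards0; lra.
rewrite big_split big_split/= leq_add2r leq_add//.
  by rewrite big_mkcond [leqRHS]big_mkcond/=; apply: leq_sum => v _; do 2!case: ifP => //.
by rewrite big_mkcond [leqRHS]big_mkcond/=; apply: leq_sum => v _; do 2!case: ifP => //.
Qed.

End LogPartition.

(** * Random subsets *)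

Section RandomSubset.
Variables (R : realType) (T : finType) (U : {set T}) (q : R).
Implicit Types (E K : {set T}) (f g : {set T} -> R).

Definition subset_weight E : R := q ^+ #|E| * (1 - q) ^+ #|U :\: E|.

Definition expect f : R := \sum_(E in powerset U) subset_weight E * f E.

Lemma eq_expect f g : (forall E, E \subset U -> f E = g E) ->
  expect f = expect g.
Proof. by move=> fg; apply: eq_bigr => E; rewrite inE => /fg ->. Qed.

Lemma expectD f g : expect (fun E => f E + g E) = expect f + expect g.
Proof. by rewrite -big_split; apply: eq_bigr => E _; rewrite mulrDr. Qed.

Lemma expectZ c f : expect (fun E => c * f E) = c * expect f.
Proof. by rewrite mulr_sumr; apply: eq_bigr => E _; rewrite mulrCA. Qed.

Lemma expectN f : expect (fun E => - f E) = - expect f.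
Proof. by rewrite -sumrN; apply: eq_bigr => E _; rewrite mulrN. Qed.

Lemma expectB f g : expect (fun E => f E - g E) = expect f - expect g.
Proof. by rewrite expectD expectN. Qed.

Lemma expect_sum (I : finType) (P : pred I) (F : I -> {set T} -> R) :
  expect (fun E => \sum_(i | P i) F i E) = \sum_(i | P i) expect (F i).
Proof.
by rewrite exchange_big; apply: eq_bigr => E _; rewrite mulr_sumr.
Qed.

Lemma expect_indep1 f (e : T) (x : R) : e \in U ->
  (forall E, f (E :\ e) = f E) ->
  expect (fun E => f E * x ^+ (e \in E)) = expect f * (1 - q + q * x).
Proof.
move=> eU fe.
pose A := \sum_(E in powerset U | e \notin E)
  q ^+ #|E| * (1 - q) ^+ #|(U :\: E) :\ e| * f E.
(* A integrates f over the coordinates other than e; the case y = 1 identifies it with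
   [expect f]. *)
suff main y : expect (fun E => f E * y ^+ (e \in E)) = A * (1 - q + q * y).
  rewrite main; congr (_ * _); have := main 1.
  rewrite mulr1 subrK mulr1 => <-.
  by apply: eq_expect => E _; rewrite expr1n mulr1.
rewrite /expect (bigID (fun E : {set T} => e \in E))/= addrC mulrDr.
congr (_ + _).
  rewrite mulr_suml; apply: eq_bigr => E /andP[_ eE].
  rewrite (negbTE eE) expr0 mulr1 /subset_weight.
  have -> : #|U :\: E| = (#|(U :\: E) :\ e|).+1.
    by rewrite (cardsD1 e (U :\: E)) in_setD eE eU.
  by rewrite exprS; ring.
rewrite (reindex_onto (fun E => e |: E) (fun E => E :\ e))/=; last first.
  by move=> E /andP[_ eE]; rewrite setD1K.
rewrite mulr_suml; apply: eq_big => [E|E].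
  rewrite !inE subUset sub1set eU/= eqxx/= andbT.
  congr (_ && _); apply/eqP/idP => [<-|eE]; first by rewrite !inE eqxx.
  exact: setU1K.
move=> /andP[/andP[_ _] /eqP eE].
have eE' : e \notin E by rewrite -eE !inE eqxx.
rewrite setU11 expr1 -{1}(fe (e |: E)) eE.
rewrite /subset_weight cardsU1 eE' add1n exprS.
have -> : U :\: (e |: E) = (U :\: E) :\ e.
  by apply/setP => z; rewrite !inE negb_or andbA.
by ring.
Qed.

(** Independence of the pairs in K from the others, as a generating function of the size of
    [E :&: K]. As [0 ^+ 0 = 1], the value x = 0 gives the event that E misses K; x = 1/2 gives a
    lower tail. *)
Lemma expect_indep f K (x : R) : K \subset U ->
  (forall E, f (E :\: K) = f E) ->
  expect (fun E => f E * x ^+ #|E :&: K|) = expect f * (1 - q + q * x) ^+ #|K|.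
Proof.
move: {2}#|K| (erefl #|K|) => k; elim: k K f => [|k IH] K f cK KU fK.
  rewrite cK expr0 mulr1; apply: eq_expect => E _.
  have /eqP -> : K == set0 by rewrite -cards_eq0 cK.
  by rewrite setI0 cards0 expr0 mulr1.
have [e eK] : exists e, e \in K by apply/card_gt0P; rewrite cK.
have cK' : #|K :\ e| = k by move: cK; rewrite (cardsD1 e) eK => -[].
have KU' : K :\ e \subset U by apply: subset_trans KU; exact: subsetDl.
have fsub K' E : K' \subset K -> f (E :\: K') = f E.
  move=> K'K; rewrite -(fK (E :\: K')) -(fK E); congr f; apply/setP => z.
  rewrite !inE; case: (boolP (z \in K)) => //= zK.
  by rewrite (contraNN _ zK)//; exact: (subsetP K'K).
have h E : f E * x ^+ #|E :&: K| =
    (f E * x ^+ #|E :&: (K :\ e)|) * x ^+ (e \in E).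
  rewrite (cardsD1 e (E :&: K)) in_setI eK andbT exprD mulrA.
  by rewrite setIDA; ring.
rewrite (eq_expect (fun E _ => h E)) expect_indep1; last 2 first.
- exact: (subsetP KU).
- move=> E; rewrite fsub ?sub1set//; congr (_ * _ ^+ _); apply: eq_card => z.
  by rewrite !inE; case: (z == e); rewrite ?andbF.
rewrite (IH (K :\ e))//; last by move=> E; apply: fsub; exact: subsetDl.
by rewrite cK cK' exprSr mulrA.
Qed.

Hypotheses (q0 : 0 <= q) (q1 : q < 1).

Lemma subset_weight_ge0 E : 0 <= subset_weight E.
Proof. by rewrite mulr_ge0 ?exprn_ge0// subr_ge0 ltW. Qed.

Lemma ler_expect f g : (forall E, E \subset U -> f E <= g E) ->
  expect f <= expect g.
Proof.
move=> fg; apply: ler_sum => E; rewrite inE => EU.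
by rewrite ler_wpM2l ?subset_weight_ge0 ?fg.
Qed.

Lemma expect_cst c : expect (fun=> c) = c.
Proof.
have one : expect (fun=> 1) = 1.
  (* For x = 0 only the empty set contributes, so (1 - q)^|U| equals the total mass times (1 -
     q)^|U|, which can be cancelled as q < 1. *)
  have := @expect_indep (fun=> 1) U 0 (subxx U) (fun=> erefl).
  rewrite mulr0 addr0 /expect [LHS](bigD1 set0)/=; last by rewrite inE sub0set.
  rewrite set0I cards0 expr0 !mulr1 big1 ?addr0; last first.
    move=> E /andP[]; rewrite inE => /setIidPl -> E0.
    by rewrite expr0n cards_eq0 (negbTE E0) !mulr0.
  rewrite /subset_weight cards0 setD0 expr0 mul1r => h.
  apply: (@mulIf _ ((1 - q) ^+ #|U|)); first by rewrite expf_neq0// subr_eq0 gt_eqF.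
  by rewrite mul1r -h.
by rewrite -[RHS]mulr1 -one -expectZ; apply: eq_expect => E _; rewrite mulr1.
Qed.

Lemma expect_ge0 f : (forall E, E \subset U -> 0 <= f E) -> 0 <= expect f.
Proof.
by move=> f0; rewrite -(expect_cst 0); apply: ler_expect.
Qed.

Lemma expect_markov (A : pred {set T}) f (c p : R) : 0 < c ->
  (forall E, E \subset U -> 0 <= f E) ->
  (forall E, E \subset U -> A E -> c <= f E) -> expect f <= c * p ->
  expect (fun E => (A E)%:R) <= p.
Proof.
move=> c0 f0 Af fp; rewrite -(ler_pM2l c0); apply: le_trans fp.
rewrite -expectZ; apply: ler_expect => E EU.
by case: (boolP (A E)) => [/(Af E EU)|_]; rewrite ?mulr1// mulr0 f0.
Qed.

(* Exponential moment of base 1/2. *)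
Lemma expect_few_le K : K \subset U ->
  expect (fun E => (#|E :&: K|%:R <= q * #|K|%:R / 4)%R%:R) <=
    expR (- (q * #|K|%:R / 4)).
Proof.
move=> KU; pose a := q * #|K|%:R / 4.
have a0 : 0 <= a by rewrite /a divr_ge0// mulr_ge0.
have half : (2^-1 : R) = expR (- ln 2) by rewrite expRN lnK// posrE.
have ln2 : ln 2 <= 1 :> R.
  by rewrite (_ : 2 = 1 + 1 :> R)//; apply: le_ln1Dx; lra.
apply: (@expect_markov _ (fun E => 2^-1 ^+ #|E :&: K|) (expR (- a))).
- exact: expR_gt0.
- by move=> E _; rewrite exprn_ge0.
- move=> E EU h; rewrite half -expRM_natl ler_expR mulrN lerN2.
  apply: le_trans h; rewrite ler_piMr//.
have := @expect_indep (fun=> 1) K 2^-1 KU (fun=> erefl).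
rewrite expect_cst mul1r; under eq_expect => E _ do rewrite mul1r.
move=> ->; rewrite -expRD.
apply: (@le_trans _ _ (expR (- (q / 2)) ^+ #|K|)).
  have h0 : 0 <= 1 - q + q * 2^-1 by move: q0 q1; lra.
  apply: lerXn2r; rewrite ?nnegrE ?expR_ge0//.
  by apply: le_trans (expR_ge1Dx _); lra.
by rewrite -expRM_natl ler_expR -/a /a; lra.
Qed.

End RandomSubset.

(** * Exploration of the random graph *)

Section RandomLayers.
Variables (R : realType) (V : finType) (r : V) (q : R).
Hypotheses (q0 : 0 <= q) (q1 : q < 1).
Implicit Types (E K : {set {set V}}) (A D : {set V}) (h : {set V} -> {set V} -> R).
Local Notation Ex := (expect (vpairs V) q).
Local Notation n := (#|V|%:R : R).
Local Notation m := (#|V|%:R * q).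

Definition star D v : {set {set V}} := [set [set u; v] | u in D].

Lemma star_sub D v : v \notin D -> star D v \subset vpairs V.
Proof.
move=> vD; apply/subsetP => _ /imsetP[u uD ->].
by rewrite inE cards2; case: (eqVneq u v) => // uv; rewrite -uv uD in vD.
Qed.

Lemma set2_injr v : injective (fun u : V => [set u; v]).
Proof.
move=> u w /setP e; have := e u; have := e w; rewrite !in_set2 !eqxx/=.
by move=> /orP[/eqP->//|/eqP->] /esym/orP[]/eqP.
Qed.

Lemma card_star D v : #|star D v| = #|D|.
Proof. by rewrite card_imset//; exact: set2_injr. Qed.

Lemma star_disjoint D v w : v \notin D -> v != w -> [disjoint star D v & star D w].
Proof.
move=> vD vw; apply/pred0P => e /=; apply/negP => /andP[].
move=> /imsetP[u uD ->] /imsetP[x xD /setP/(_ v)]; rewrite !in_set2 eqxx orbT.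
by move=> /esym/orP[/eqP vx|/eqP]; [rewrite vx xD in vD|apply/eqP].
Qed.

Lemma star_avoid A D v e : [disjoint D & A] -> v \notin A -> e \in star D v ->
  [disjoint e & A].
Proof.
move=> DA vA /imsetP[u uD ->]; apply/pred0P => x /=; apply/negP.
rewrite in_set2 => /andP[/orP[]/eqP -> xA]; last by rewrite xA in vA.
by have /pred0P/(_ u) := DA; rewrite /= uD xA.
Qed.

Lemma exists_nbr E D v :
  ([exists u in D, adj E u v])%:R = 1 - 0 ^+ #|E :&: star D v| :> R.
Proof.
rewrite expr0n cards_eq0; case: (boolP [exists u in D, adj E u v]).
  move=> /existsP[u /andP[uD uv]]; rewrite (_ : (_ == set0) = false) ?subr0//.
  apply/negbTE/set0Pn; exists [set u; v]; rewrite in_setI [_ \in E]uv.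
  by apply/imsetP; exists u.
move=> /existsPn no; rewrite (_ : (_ == set0)) ?subrr//.
apply/eqP/setP => e; rewrite in_setI in_set0; apply/negP => /andP[eE].
by move=> /imsetP[u uD eu]; have := no u; rewrite uD /= /adj/= -eu eE.
Qed.

Definition at_state k A D E : bool := (inner E r k == A) && (layer E r k == D).

Lemma inner_layer_disjoint E k : [disjoint layer E r k & inner E r k].
Proof.
apply/pred0P => v /=; rewrite !inE; case: (connect _ _ _) => //=.
by case: ltngtP.
Qed.

(** Conditioning on the exploration: A is the set of vertices at distance less than k and D is layer
    k, which makes them disjoint. *)
Lemma expect_states k h (g : {set {set V}} -> R) :
  Ex (fun E => h (inner E r k) (layer E r k) * g E) =
  \sum_(s : {set V} * {set V} | [disjoint s.2 & s.1])
    h s.1 s.2 * Ex (fun E => (at_state k s.1 s.2 E)%:R * g E).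
Proof.
under [RHS]eq_bigr do rewrite -expectZ.
rewrite -expect_sum; apply: eq_expect => E _.
rewrite (bigD1 (inner E r k, layer E r k)) ?inner_layer_disjoint//=.
rewrite /at_state !eqxx/= mul1r big1 ?addr0// => -[A D] /andP[_ ne]/=.
case: (boolP (_ && _)) => [/andP[/eqP iA /eqP lD]|_]; last by rewrite mul0r mulr0.
by rewrite iA lD eqxx in ne.
Qed.

Lemma at_state_setD k A D E K : (forall e : {set V}, e \in K -> [disjoint e & A]) ->
  at_state k A D (E :\: K) = at_state k A D E.
Proof. exact: layer_setD. Qed.

Section OneStep.
Variables (k : nat) (A D : {set V}).
Hypothesis DA : [disjoint D & A].
Let O := ~: (A :|: D).
Let st E : R := (at_state k A D E)%:R.
Let rho : R := (1 - q) ^+ #|D|.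
Let y v E : R := 0 ^+ #|E :&: star D v|.

Let notO v : v \in O -> v \notin A /\ v \notin D.
Proof. by rewrite inE in_setU => /norP. Qed.

Let st_star v E : v \in O -> st (E :\: star D v) = st E.
Proof.
move=> /notO[vA vD]; rewrite /st at_state_setD// => e; exact: star_avoid.
Qed.

Let expect_y v : v \in O -> Ex (fun E => st E * y v E) = Ex st * rho.
Proof.
move=> vO; have [vA vD] := notO vO.
rewrite expect_indep ?star_sub//; last by move=> E; exact: st_star.
by rewrite mulr0 addr0 card_star.
Qed.

Let expect_yy v w : v \in O -> w \in O -> v != w ->
  Ex (fun E => st E * y w E * y v E) = Ex st * rho * rho.
Proof.
move=> vO wO vw; have [vA vD] := notO vO; have [wA wD] := notO wO.
rewrite expect_indep ?star_sub//.
  by rewrite expect_y// mulr0 addr0 card_star.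
move=> E; rewrite st_star// /y; congr (_ * _ ^+ _); apply: eq_card => e.
rewrite !inE; case: (boolP (e \in star D w)); rewrite ?andbF// !andbT => ew.
by have /pred0P/(_ e) := star_disjoint vD vw; rewrite /= ew andbT => ->.
Qed.

Let layer_step E : st E * #|layer E r k.+1|%:R =
  st E * \sum_(v in O) (1 - y v E).
Proof.
rewrite /st; case: (boolP (at_state _ _ _ _)) => [/andP[/eqP iA /eqP lD]|]; last first.
  by rewrite !mul0r.
rewrite !mul1r -sum1_card natr_sum big_mkcond [RHS]big_mkcond/=.
apply: eq_bigr => v _; rewrite in_layerS lD innerS iA lD -exists_nbr.
by rewrite [v \in O]inE; case: (_ \in _ :|: _) => //=; case: ifP.
Qed.

Lemma expect_step_mean : Ex (fun E => st E * #|layer E r k.+1|%:R) =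
  Ex (fun E => st E * (#|O|%:R * (1 - rho))).
Proof.
rewrite (eq_expect q (fun E _ => layer_step E)).
under eq_expect do rewrite mulr_sumr.
rewrite expect_sum.
under eq_bigr => v vO.
  under eq_expect do rewrite mulrBr mulr1.
  rewrite expectB expect_y//.
  over.
rewrite sumr_const -mulr_natl; under [RHS]eq_expect do rewrite mulrC.
by rewrite expectZ; ring.
Qed.

(** Given the state, each vertex of O joins layer k + 1 with probability 1 - rho, and the stars of
    distinct vertices are disjoint sets of pairs. So the covariances vanish and the binomial
    variance is left. *)
Lemma expect_step_var :
  Ex (fun E => st E * (#|layer E r k.+1|%:R - #|O|%:R * (1 - rho)) ^+ 2) =
  Ex (fun E => st E * (#|O|%:R * (rho * (1 - rho)))).
Proof.
have stK E : st E * st E = st E by rewrite /st; case: at_state; rewrite ?mulr1 ?mulr0.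
have sq E : st E * (#|layer E r k.+1|%:R - #|O|%:R * (1 - rho)) ^+ 2 =
    \sum_(v in O) \sum_(w in O) st E * ((rho - y v E) * (rho - y w E)).
  rewrite -[in LHS](stK E) expr2 mulrACA.
  have -> : st E * (#|layer E r k.+1|%:R - #|O|%:R * (1 - rho)) =
      st E * \sum_(v in O) (rho - y v E).
    rewrite mulrBr layer_step -mulrBr; congr (_ * _).
    rewrite mulr_natl -sumr_const -sumrB; apply: eq_bigr => v _; ring.
  rewrite mulrACA stK big_distrlr/= mulr_sumr; apply: eq_bigr => v _.
  by rewrite mulr_sumr.
rewrite (eq_expect q (fun E _ => sq E)) expect_sum.
transitivity (\sum_(v in O) Ex st * (rho * (1 - rho))); last first.
  rewrite sumr_const -mulr_natl; under [RHS]eq_expect do rewrite mulrC.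
  by rewrite expectZ; ring.
apply: eq_bigr => v vO; rewrite expect_sum (bigD1 v)//= big1 ?addr0.
  have yy E : st E * ((rho - y v E) * (rho - y v E)) =
      rho ^+ 2 * st E + (1 - 2 * rho) * (st E * y v E).
    have -> : (rho - y v E) * (rho - y v E) = rho ^+ 2 - 2 * rho * y v E + y v E * y v E.
      by ring.
    have -> : y v E * y v E = y v E.
      by rewrite /y expr0n; case: (_ == _); rewrite ?mulr1 ?mulr0.
    by ring.
  rewrite (eq_expect q (fun E _ => yy E)) expectD !expectZ expect_y//.
  by ring.
move=> w /andP[wO wv].
have yy E : st E * ((rho - y v E) * (rho - y w E)) =
    rho ^+ 2 * st E - rho * (st E * y v E) - rho * (st E * y w E)
    + st E * y w E * y v E by ring.
rewrite (eq_expect q (fun E _ => yy E)) expectD !expectB !expectZ !expect_y//.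
by rewrite expect_yy 1?eq_sym//; ring.
Qed.

Lemma expect_step_nbrs v : v \in O ->
  Ex (fun E => st E * #|nbrs E D v|%:R) = Ex (fun E => st E * (q * #|D|%:R)).
Proof.
move=> vO; have [vA vD] := notO vO.
(* The indicator of an edge is one minus the indicator that E misses a singleton, to which
   [expect_indep] applies with x = 0. *)
have cardE E : st E * #|nbrs E D v|%:R =
    \sum_(u in D) (st E - st E * 0 ^+ #|E :&: [set [set u; v]]|).
  under eq_bigr do rewrite -{1}[st E]mulr1 -mulrBr.
  rewrite -mulr_sumr; congr (_ * _).
  rewrite -sum1_card natr_sum (eq_bigl (fun u => (u \in D) && adj E u v)); last first.
    by move=> u; rewrite inE.
  rewrite big_mkcondr/=; apply: eq_bigr => u uD.
  rewrite expr0n cards_eq0 setI_eq0 disjoint_sym disjoints1 /adj/=.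
  by case: (_ \in E); rewrite ?subr0 ?subrr.
rewrite (eq_expect q (fun E _ => cardE E)) expect_sum.
transitivity (\sum_(u in D) Ex st * q); last first.
  rewrite sumr_const -mulr_natl; under [RHS]eq_expect do rewrite mulrC.
  by rewrite expectZ; ring.
apply: eq_bigr => u uD; rewrite expectB expect_indep.
- by rewrite cards1 expr1; ring.
- apply/subsetP => e; rewrite in_set1 => /eqP ->.
  by apply: (subsetP (star_sub vD)); apply/imsetP; exists u.
- move=> E; rewrite /st at_state_setD// => e; rewrite in_set1 => /eqP ->.
  by apply: (star_avoid DA vA); apply/imsetP; exists u.
Qed.

End OneStep.

(* Conditional mean of the size of layer k + 1 given the first k layers. *)
Definition step_mean k E : R :=
  (n - #|inner E r k.+1|%:R) * (1 - (1 - q) ^+ #|layer E r k|).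

Let step_fun A D : R := #|~: (A :|: D)|%:R * (1 - (1 - q) ^+ #|D|).

Let step_meanE k E : step_mean k E = step_fun (inner E r k) (layer E r k).
Proof.
rewrite /step_mean /step_fun -innerS; congr (_ * _).
by rewrite [in RHS]cardsCs setCK natrB// max_card.
Qed.

(** The function [h] of the past is kept free because the second moment takes it to be the
    conditional mean itself. *)
Lemma expect_layerS_mean k h :
  Ex (fun E => h (inner E r k) (layer E r k) * #|layer E r k.+1|%:R) =
  Ex (fun E => h (inner E r k) (layer E r k) * step_mean k E).
Proof.
under [RHS]eq_expect do rewrite step_meanE.
have -> : Ex (fun E => h (inner E r k) (layer E r k) *
      step_fun (inner E r k) (layer E r k)) =
    Ex (fun E => (h (inner E r k) (layer E r k) *
      step_fun (inner E r k) (layer E r k)) * 1).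
  by apply: eq_expect => E _; rewrite mulr1.
rewrite expect_states (@expect_states k (fun A D => h A D * step_fun A D)).
apply: eq_bigr => -[A D]/= DA; rewrite expect_step_mean//.
under eq_expect do rewrite mulrC.
by rewrite expectZ -/(step_fun A D); under [in RHS]eq_expect do rewrite mulr1; ring.
Qed.

(** A binomial variance is at most the mean. *)
Lemma expect_layerS_var k h : (forall A D, 0 <= h A D) ->
  Ex (fun E => h (inner E r k) (layer E r k) *
     (#|layer E r k.+1|%:R - step_mean k E) ^+ 2) <=
  Ex (fun E => h (inner E r k) (layer E r k) * step_mean k E).
Proof.
move=> h0; under [leRHS]eq_expect do rewrite step_meanE.
have -> : Ex (fun E => h (inner E r k) (layer E r k) *
      step_fun (inner E r k) (layer E r k)) =
    Ex (fun E => (h (inner E r k) (layer E r k) *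
      step_fun (inner E r k) (layer E r k)) * 1).
  by apply: eq_expect => E _; rewrite mulr1.
rewrite expect_states (@expect_states k (fun A D => h A D * step_fun A D)).
apply: ler_sum => -[A D]/= DA.
have -> : Ex (fun E => (at_state k A D E)%:R *
      (#|layer E r k.+1|%:R - step_mean k E) ^+ 2) =
    Ex (fun E => (at_state k A D E)%:R *
      (#|layer E r k.+1|%:R - step_fun A D) ^+ 2).
  apply: eq_expect => E _; rewrite step_meanE.
  case: (boolP (at_state _ _ _ _)) => [/andP[/eqP -> /eqP ->]//|].
  by rewrite !mul0r.
rewrite expect_step_var//; under eq_expect do rewrite mulrC.
rewrite expectZ -[leRHS]mulrA ler_wpM2l//; under [in leRHS]eq_expect do rewrite mulr1.
rewrite ler_wpM2r//; first by apply: expect_ge0 => // E _; case: at_state.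
rewrite /step_fun ler_wpM2l//.
have : 0 <= (1 - q) ^+ #|D| <= 1.
  by rewrite exprn_ge0 ?exprn_ile1//; move: q0 q1; lra.
by move=> /andP[a b]; rewrite ler_piMl; lra.
Qed.

End RandomLayers.

(** * Moments of layer sizes, parents and degrees *)

Section LayerMoments.
Variables (R : realType) (V : finType) (r : V) (q : R).
Hypotheses (q0 : 0 < q) (q1 : q < 1).
Local Notation Ex := (expect (vpairs V) q).
Local Notation n := (#|V|%:R : R).
Local Notation m := (#|V|%:R * q).
Hypothesis m2 : 2 <= m.
Local Notation lsz k := (fun E : {set {set V}} => #|layer E r k|%:R : R).
Local Notation step_mean := (step_mean r q).

Let q0' : 0 <= q := ltW q0.
Let m0 : 0 <= m. Proof. by move: m2; lra. Qed.

Lemma bernoulli_ge (d : nat) : 1 - (1 - q) ^+ d <= q * d%:R.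
Proof.
elim: d => [|d IH]; first by rewrite expr0 mulr0; lra.
have : 0 <= (1 - q) * (q * d%:R - (1 - (1 - q) ^+ d)).
  by rewrite mulr_ge0//; move: q1 IH; lra.
have : 0 <= q * (q * d%:R) by rewrite !mulr_ge0.
by rewrite exprS -natr1; lra.
Qed.

Lemma bernoulli_le (d : nat) :
  q * d%:R - (q * d%:R) ^+ 2 <= 1 - (1 - q) ^+ d.
Proof.
elim: d => [|d IH]; first by rewrite expr0 mulr0; lra.
set x := q * d%:R in IH *; have x0 : 0 <= x by rewrite mulr_ge0.
have : 0 <= (1 - q) * (1 - (1 - q) ^+ d - (x - x ^+ 2)).
  by rewrite mulr_ge0//; move: q1 IH; lra.
have : 0 <= q * x by rewrite mulr_ge0.
have : 0 <= q * x ^+ 2 by rewrite mulr_ge0// exprn_ge0.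
have : 0 <= q ^+ 2 by rewrite exprn_ge0.
have -> : q * d.+1%:R = x + q by rewrite /x -natr1; ring.
by rewrite [(1 - q) ^+ d.+1]exprS; lra.
Qed.

Lemma inner_le k (E : {set {set V}}) : #|inner E r k|%:R <= n.
Proof. by rewrite ler_nat max_card. Qed.

Let escape01 (d : nat) : 0 <= 1 - (1 - q) ^+ d <= 1.
Proof.
by rewrite subr_ge0 exprn_ile1 ?gerBl ?exprn_ge0//; move: q0 q1; lra.
Qed.

Lemma step_mean_ge0 k E : 0 <= step_mean k E.
Proof.
rewrite mulr_ge0 ?subr_ge0 ?inner_le//.
by have /andP[] := escape01 #|layer E r k|; rewrite subr_ge0.
Qed.

Lemma step_mean_le k E : step_mean k E <= m * lsz k E.
Proof.
rewrite /step_mean -mulrA; apply: ler_pM.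
- by rewrite subr_ge0 inner_le.
- by have /andP[] := escape01 #|layer E r k|.
- by rewrite gerBl.
- exact: bernoulli_ge.
Qed.

(** The first loss accounts for vertices reached from several vertices of layer k, the second for
    edges to vertices that are already explored. *)
Lemma step_mean_ge k E :
  m * lsz k E - m * q * lsz k E ^+ 2 - q * (#|inner E r k.+1|%:R * lsz k E)
    <= step_mean k E.
Proof.
rewrite /step_mean; set d := #|layer E r k|; set i := #|_|.
have : 0 <= n * (1 - (1 - q) ^+ d - (q * d%:R - (q * d%:R) ^+ 2)).
  by rewrite mulr_ge0// subr_ge0 bernoulli_le.
have : 0 <= i%:R * (q * d%:R - (1 - (1 - q) ^+ d)).
  by rewrite mulr_ge0// subr_ge0 bernoulli_ge.
by move: ((1 - q) ^+ d) (d%:R : R) (i%:R : R) (n : R) => p x y z; lra.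
Qed.

Let layerS_mean k : Ex (lsz k.+1) = Ex (step_mean k).
Proof.
have := @expect_layerS_mean R V r q k (fun _ _ => 1).
by under eq_expect do rewrite mul1r; under [in RHS]eq_expect do rewrite mul1r.
Qed.

Lemma expect_layer0 : Ex (lsz 0%N) = 1.
Proof.
rewrite -[RHS](expect_cst (vpairs V) q1); apply: eq_expect => E _.
by rewrite layer0 cards1.
Qed.

Lemma expect_layer_le k : Ex (lsz k) <= m ^+ k.
Proof.
elim: k => [|k IH]; first by rewrite expect_layer0.
rewrite layerS_mean exprS; apply: (@le_trans _ _ (m * Ex (lsz k))).
  by rewrite -expectZ; apply: ler_expect => // E _; exact: step_mean_le.
by rewrite ler_wpM2l.
Qed.

Lemma layerS_var k : Ex (fun E => (lsz k.+1 E - step_mean k E) ^+ 2) <= m ^+ k.+1.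
Proof.
have := @expect_layerS_var R V r q q0' q1 k (fun _ _ => 1) (fun _ _ => ler01).
under eq_expect do rewrite mul1r; under [in leRHS]eq_expect do rewrite mul1r.
move=> /le_trans; apply; rewrite -layerS_mean; exact: expect_layer_le.
Qed.

(** Divided by m - 1, the right-hand side is the second moment of generation k in a Galton-Watson
    process with Poisson offspring of mean m; it solves the recursion of [stepE] with equality. *)
Lemma expect_layer2_le_geo k :
  (m - 1) * Ex (fun E => lsz k E ^+ 2) <= m ^+ k * (m ^+ k * (m - 1) + (m ^+ k - 1)).
Proof.
elim: k => [|k IH].
  have -> : Ex (fun E => lsz 0%N E ^+ 2) = 1.
    rewrite -[RHS]expect_layer0; apply: eq_expect => E _.
    by rewrite layer0 cards1 mulr1n expr1n.
  by rewrite expr0; lra.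
have stepE : Ex (fun E => lsz k.+1 E ^+ 2) <=
    m ^+ k.+1 + m ^+ 2 * Ex (fun E => lsz k E ^+ 2).
  (* The conditional mean is orthogonal to the fluctuation around it. *)
  have sm : Ex (fun E => step_mean k E * lsz k.+1 E) = Ex (fun E => step_mean k E ^+ 2).
    have := @expect_layerS_mean R V r q k
      (fun A D => (n - #|A :|: D|%:R) * (1 - (1 - q) ^+ #|D|)).
    under eq_expect do rewrite -innerS -/(step_mean k _).
    move=> ->; apply: eq_expect => E _; by rewrite -innerS expr2.
  have -> : Ex (fun E => lsz k.+1 E ^+ 2) =
     Ex (fun E => (lsz k.+1 E - step_mean k E) ^+ 2) + Ex (fun E => step_mean k E ^+ 2).
    have -> : Ex (fun E => lsz k.+1 E ^+ 2) =
        Ex (fun E => (lsz k.+1 E - step_mean k E) ^+ 2 +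
          2 * (step_mean k E * lsz k.+1 E) - step_mean k E ^+ 2).
      by apply: eq_expect => E _; ring.
    by rewrite expectB expectD expectZ sm; lra.
  apply: lerD (layerS_var k) _; rewrite -expectZ.
  apply: ler_expect => // E _; rewrite -exprMn lerXn2r ?nnegrE ?step_mean_ge0//.
    by rewrite mulr_ge0.
  exact: step_mean_le.
have h1 : 0 <= m - 1 by move: m2; lra.
have := ler_wpM2l h1 stepE.
have : 0 <= m ^+ 2 * (m ^+ k * (m ^+ k * (m - 1) + (m ^+ k - 1)) -
    (m - 1) * Ex (fun E => lsz k E ^+ 2)).
  by rewrite mulr_ge0 ?exprn_ge0// subr_ge0.
rewrite [m ^+ k.+1]exprS; set t := m ^+ k; lra.
Qed.

Lemma expect_layer2_le k : Ex (fun E => lsz k E ^+ 2) <= 2 * (m ^+ k) ^+ 2.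
Proof.
have h1 : 0 < m - 1 by move: m2; lra.
rewrite -(ler_pM2l h1); apply: le_trans (expect_layer2_le_geo k) _.
have t0 : 0 <= m ^+ k by rewrite exprn_ge0.
have : 0 <= (m ^+ k) ^+ 2 * (m - 2) by rewrite mulr_ge0 ?exprn_ge0// subr_ge0.
by lra.
Qed.

(** The inequality 2 (b X) (a Y) <= (b X)^2 + (a Y)^2, with weights for which both second moments
    have the same bound. *)
Lemma expect_layerM_le j k :
  Ex (fun E => lsz j E * lsz k E) <= 2 * (m ^+ j * m ^+ k).
Proof.
have m0' : 0 < m by move: m2; lra.
set a := m ^+ j; set b := m ^+ k.
have a0 : 0 < a by rewrite exprn_gt0.
have b0 : 0 < b by rewrite exprn_gt0.
have ab : 0 < 2 * (a * b) by rewrite !mulr_gt0.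
rewrite -(ler_pM2l ab) -expectZ.
apply: (@le_trans _ _ (Ex (fun E => b ^+ 2 * lsz j E ^+ 2 + a ^+ 2 * lsz k E ^+ 2))).
  apply: ler_expect => // E _.
  by have := sqr_ge0 (b * lsz j E - a * lsz k E); lra.
rewrite expectD !expectZ.
have h1 := ler_wpM2l (sqr_ge0 b) (expect_layer2_le j).
have h2 := ler_wpM2l (sqr_ge0 a) (expect_layer2_le k).
by rewrite -/a -/b in h1 h2; lra.
Qed.

Lemma sum_geo_le k : \sum_(j < k.+1) m ^+ j <= 2 * m ^+ k.
Proof.
elim: k => [|k IH]; first by rewrite big_ord1 expr0; lra.
rewrite big_ord_recr/=.
have : 0 <= m ^+ k * (m - 2) by rewrite mulr_ge0 ?exprn_ge0 ?subr_ge0.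
by move: IH; rewrite [m ^+ k.+1]exprS; lra.
Qed.

Lemma expect_inner_le k : Ex (fun E => #|inner E r k.+1|%:R) <= 2 * m ^+ k.
Proof.
under eq_expect do rewrite card_inner natr_sum.
rewrite expect_sum; apply: le_trans (sum_geo_le k).
by apply: ler_sum => j _; exact: expect_layer_le.
Qed.

(** In other words the mean of layer k is at least m^k - 8 m^(2k) / n. One step loses at most 2 m q
    m^(2k) + 4 q m^(2k), and the constant 8 closes the induction because 12 m + 2 m^2 <= 8 m^2 for m
    >= 2. *)
Lemma expect_layer_ge k : m ^+ k.+1 - 8 * q * (m ^+ k) ^+ 2 <= m * Ex (lsz k).
Proof.
elim: k => [|k IH]; first by rewrite expect_layer0 expr0 expr1; move: q0; lra.
have inn : Ex (fun E => #|inner E r k.+1|%:R * lsz k E) <= 4 * (m ^+ k) ^+ 2.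
  under eq_expect do rewrite card_inner natr_sum mulr_suml.
  rewrite expect_sum.
  apply: (@le_trans _ _ (\sum_(j < k.+1) 2 * (m ^+ j * m ^+ k))).
    by apply: ler_sum => j _; exact: expect_layerM_le.
  rewrite -mulr_sumr -mulr_suml.
  have := ler_wpM2r (exprn_ge0 k m0) (sum_geo_le k); lra.
have low : m * Ex (lsz k) - m * q * Ex (fun E => lsz k E ^+ 2)
    - q * Ex (fun E => #|inner E r k.+1|%:R * lsz k E) <= Ex (lsz k.+1).
  rewrite layerS_mean -!expectZ -!expectB; apply: ler_expect => // E _.
  exact: step_mean_ge.
have mq : 0 <= m * q by rewrite mulr_ge0.
have h1 := ler_wpM2l mq (expect_layer2_le k).
have h2 := ler_wpM2l q0' inn.
have t2 : 0 <= q * (m ^+ k) ^+ 2 by rewrite mulr_ge0 ?exprn_ge0.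
have mm : 0 <= m * (m - 2) by rewrite mulr_ge0 ?subr_ge0.
have h3 := mulr_ge0 t2 mm.
set x := Ex (lsz k) in IH low; set x' := Ex (lsz k.+1) in low *.
set z := Ex _ in h1 low; set w := Ex _ in h2 low; set t := m ^+ k in IH h1 h2 h3.
have h4 : m * (m * x - m * q * (2 * t ^+ 2) - q * (4 * t ^+ 2)) <= m * x'.
  by rewrite ler_wpM2l//; lra.
have h5 := ler_wpM2l m0 IH.
move: h3 h4 h5; rewrite !exprS -/t; lra.
Qed.

Lemma layer_variance k : Ex (fun E => (lsz k E - m ^+ k) ^+ 2) <=
  (m ^+ k) ^+ 2 * ((m - 1)^-1 + 16 * (m ^+ k / n)).
Proof.
have m0' : 0 < m by move: m2; lra.
have m1 : 0 < m - 1 by move: m2; lra.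
have nn : n != 0 by apply: contraTneq m2 => ->; rewrite mul0r -ltNge.
have -> : Ex (fun E => (lsz k E - m ^+ k) ^+ 2) =
    Ex (fun E => lsz k E ^+ 2) - 2 * m ^+ k * Ex (lsz k) + (m ^+ k) ^+ 2.
  rewrite -[in RHS](expect_cst (vpairs V) q1 ((m ^+ k) ^+ 2)) -expectZ -expectB -expectD.
  by apply: eq_expect => E _; ring.
set t := m ^+ k; have t1 : 0 <= t by rewrite exprn_ge0.
have h1 : Ex (fun E => lsz k E ^+ 2) <= t ^+ 2 + t ^+ 2 / (m - 1).
  rewrite -(ler_pM2l m1); apply: le_trans (expect_layer2_le_geo k) _.
  have -> : (m - 1) * (t ^+ 2 + t ^+ 2 / (m - 1)) = (m - 1) * t ^+ 2 + t ^+ 2.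
    by field; rewrite gt_eqF.
  by rewrite -/t; lra.
have h2 : t - 8 * (t ^+ 2 / n) <= Ex (lsz k).
  rewrite -(ler_pM2l m0'); apply: le_trans (expect_layer_ge k).
  have -> : m * (t - 8 * (t ^+ 2 / n)) = m * t - 8 * q * t ^+ 2 by field.
  by rewrite [m ^+ k.+1]exprS.
have t2 : 0 <= 2 * t by rewrite mulr_ge0.
have := ler_wpM2l t2 h2.
set i := n^-1; set j := (m - 1)^-1; move: h1; rewrite -/j -/i; lra.
Qed.

(** An unexplored vertex outside layer k + 1 has no neighbour in layer k. On the right the index set
    depends on the state only, so each degree can be averaged given the state. *)
Lemma layer_parents E k :
  (\sum_(v in layer E r k.+1) #|bfs_parents E r v|)%N =
  (\sum_(v in ~: (inner E r k :|: layer E r k)) #|nbrs E (layer E r k) v|)%N.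
Proof.
rewrite big_mkcond [RHS]big_mkcond/=; apply: eq_bigr => v _.
rewrite [v \in ~: _]inE -innerS in_layerS.
case: (boolP (v \in inner E r k.+1)) => //= vi.
case: (boolP [exists u in _, _]) => [ex|/existsPn no]; last first.
  apply/esym/eqP; rewrite cards_eq0; apply/eqP/setP => u; rewrite in_set0 inE.
  by apply/negbTE/no.
have : v \in layer E r k.+1 by rewrite in_layerS vi.
rewrite inE => /andP[vC /eqP dv].
apply: eq_card => u; apply/idP/idP.
  move=> /(bfs_parentsP vC)[uC uv du]; rewrite inE uv andbT inE uC/=.
  by rewrite dv in du; case: du => ->.
by rewrite !inE dv => /andP[/andP[_ /eqP ->] ->]; rewrite eqxx.
Qed.

Lemma expect_layer_parents k :
  Ex (fun E => (\sum_(v in layer E r k.+1) #|bfs_parents E r v|)%:R) <= m ^+ k.+1.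
Proof.
rewrite exprS; apply: (@le_trans _ _ (m * Ex (lsz k))); last first.
  by rewrite ler_wpM2l// expect_layer_le.
rewrite -expectZ.
have -> : Ex (fun E => (\sum_(v in layer E r k.+1) #|bfs_parents E r v|)%:R) =
    Ex (fun E => 1 * (\sum_(v in ~: (inner E r k :|: layer E r k))
                   #|nbrs E (layer E r k) v|)%:R).
  by apply: eq_expect => E _; rewrite layer_parents mul1r.
have -> : Ex (fun E => m * lsz k E) = Ex (fun E => 1 * (m * lsz k E)).
  by apply: eq_expect => E _; rewrite mul1r.
rewrite (@expect_states R V r q k (fun _ _ => 1)).
rewrite (@expect_states R V r q k (fun _ _ => 1)).
apply: ler_sum => -[A D]/= DA; rewrite !mul1r.
have -> : Ex (fun E => (at_state r k A D E)%:R *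
      (\sum_(v in ~: (inner E r k :|: layer E r k)) #|nbrs E (layer E r k) v|)%:R) =
    Ex (fun E => \sum_(v in ~: (A :|: D)) (at_state r k A D E)%:R * #|nbrs E D v|%:R).
  apply: eq_expect => E _; rewrite -mulr_sumr -natr_sum.
  case: (boolP (at_state _ _ _ _ _)) => [/andP[/eqP -> /eqP ->]//|].
  by rewrite !mul0r.
rewrite expect_sum.
under eq_bigr => v vO do rewrite expect_step_nbrs//.
rewrite -expect_sum; apply: ler_expect => // E _.
rewrite sumr_const -[leLHS]mulr_natl.
case: (boolP (at_state _ _ _ _ _)) => [/andP[_ /eqP ->]|]; last first.
  by rewrite !mul0r mulr0.
rewrite !mul1r -mulrA ler_wpM2r// ?ler_nat ?max_card//.
by rewrite mulr_ge0.
Qed.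

Lemma expect_parent_sum k : Ex (fun E => (parent_sum E r k.+1)%:R) <= 2 * m ^+ k.
Proof.
suff : Ex (fun E => (parent_sum E r k.+1)%:R) <= \sum_(j < k.+1) m ^+ j.
  by move=> /le_trans; apply; exact: sum_geo_le.
elim: k => [|k IH].
  rewrite big_ord1 expr0 -[leRHS](expect_cst (vpairs V) q1).
  apply: ler_expect => // E _; rewrite /parent_sum innerS inner0 layer0 set0U.
  by rewrite setDv big_set0.
rewrite big_ord_recr/=; apply: (le_trans _ (lerD IH (expect_layer_parents k))).
rewrite -expectD; apply: ler_expect => // E _; rewrite -natrD ler_nat /parent_sum.
rewrite big_mkcond [X in (_ <= X + _)%N]big_mkcond [X in (_ <= _ + X)%N]big_mkcond/=.
rewrite -big_split/=; apply: leq_sum => v _.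
rewrite !in_setD1 [inner E r k.+2]innerS in_setU.
by case: (v != r); case: (v \in inner _ _ _); case: (v \in layer _ _ _) => //=; lia.
Qed.

Lemma expect_degree_sum : Ex (fun E => (degree_sum E)%:R) <= n * m.
Proof.
have -> : Ex (fun E => (degree_sum E)%:R) =
    Ex (fun E => \sum_v \sum_u ([set u; v] \in E)%:R).
  apply: eq_expect => E _; rewrite /degree_sum natr_sum; apply: eq_bigr => v _.
  rewrite -sum1_card natr_sum big_mkcond/=; apply: eq_bigr => u _.
  by rewrite !inE/= /adj/=; case: (_ \in _).
rewrite expect_sum.
apply: (@le_trans _ _ (\sum_(v : V) \sum_(u : V) q)); last first.
  by rewrite !sumr_const -mulr_natl -[q *+ _]mulr_natl; lra.
apply: ler_sum => v _; rewrite expect_sum; apply: ler_sum => u _.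
have [eU|eU] := boolP ([set u; v] \in vpairs V); last first.
  have -> : Ex (fun E => ([set u; v] \in E)%:R) = Ex (fun=> 0).
    apply: eq_expect => E /subsetP sE.
    by rewrite (negbTE (contraNN (sE _) eU)).
  by rewrite expect_cst.
have -> : Ex (fun E => ([set u; v] \in E)%:R) =
    Ex (fun E => 1 - 1 * 0 ^+ ([set u; v] \in E)).
  by apply: eq_expect => E _; case: (_ \in _); rewrite /= ?expr1 ?expr0; lra.
by rewrite expectB expect_indep1// expect_cst//; lra.
Qed.

Definition between (S W : {set V}) : {set {set V}} :=
  [set [set p.1; p.2] | p in setX S W].

Lemma card_between (S W : {set V}) : [disjoint S & W] ->
  #|between S W| = (#|S| * #|W|)%N.
Proof.
move=> SW; rewrite card_in_imset ?cardsX// => -[u v] [u' v'].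
rewrite !in_setX/= => /andP[uS vW] /andP[u'S v'W] e.
have nSW x : x \in S -> x \in W -> False.
  by move=> xS xW; have /pred0P/(_ x) := SW; rewrite /= xS xW.
have /setP e' := e; have := e' u; have := e' v.
rewrite !in_set2 !eqxx ?orbT/=.
move=> /esym/orP[/eqP vu|/eqP ->]; first by case: (nSW v); rewrite // vu.
by move=> /esym/orP[/eqP ->//|/eqP uv]; case: (nSW u); rewrite // uv.
Qed.

Lemma between_few E (S W : {set V}) (t : R) :
  {in W, forall v, #|nbrs E S v|%:R <= t} ->
  #|E :&: between S W|%:R <= t * #|W|%:R.
Proof.
move=> Wt; pose Q := [set p in setX S W | adj E p.1 p.2].
apply: (@le_trans _ _ #|Q|%:R).
  rewrite ler_nat; apply: leq_trans (leq_imset_card (fun p => [set p.1; p.2]) (mem Q)).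
  apply: subset_leq_card; apply/subsetP => e; rewrite in_setI => /andP[eE].
  move=> /imsetP[p pSW ep]; apply/imsetP; exists p => //.
  by rewrite inE pSW /adj/= -ep eE.
have -> : #|Q| = (\sum_(v in W) #|nbrs E S v|)%N.
  under eq_bigr do rewrite -sum1_card.
  rewrite pair_big_dep/= -sum1_card (reindex (fun p : V * V => (p.2, p.1)))/=.
    apply: eq_bigl => -[u v] /=; rewrite !inE/=.
    by case: (u \in W); case: (v \in S); rewrite ?andbF.
  by exists (fun p => (p.2, p.1)) => -[].
rewrite natr_sum mulr_natr -sumr_const; apply: ler_sum => v vW; exact: Wt.
Qed.

(** For disjoint S and W with q |S| |W| >= 16 n, at most a quarter of the expected edges are present
    between them with probability at most e^(-4 n) <= 16^(-n), while there are 4^n pairs. All S are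
    treated at once since S will depend on the graph. *)
Lemma expect_low_degree :
  Ex (fun E => [exists S : {set V},
     16 * n <= q * #|S|%:R * #|low_degree E S (q * #|S|%:R / 4)|%:R]%:R) <=
  (4^-1) ^+ #|V|.
Proof.
pose few (S W : {set V}) (E : {set {set V}}) : R :=
  ([&& [disjoint S & W], 16 * n <= q * #|S|%:R * #|W|%:R &
     #|E :&: between S W|%:R <= q * #|S|%:R / 4 * #|W|%:R])%:R.
apply: (@le_trans _ _ (Ex (fun E => \sum_S \sum_W few S W E))).
  apply: ler_expect => // E _; case: existsP => [[S bad]|_]; last first.
    by apply: sumr_ge0 => S _; apply: sumr_ge0 => W _; rewrite /few ler0n.
  set W := low_degree _ _ _ in bad.
  rewrite (bigD1 S)//= (bigD1 W)//=.
  have -> : few S W E = 1.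
    rewrite /few bad/= between_few ?andbT.
      rewrite (_ : [disjoint _ & _])//; apply/pred0P => v /=.
      by rewrite inE; case: (v \in S).
    by move=> v; rewrite inE => /andP[].
  have p1 : 0 <= \sum_(W' | W' != W) few S W' E by apply: sumr_ge0 => W' _; rewrite /few ler0n.
  have p2 : 0 <= \sum_(S' | S' != S) \sum_W' few S' W' E.
    by apply: sumr_ge0 => S' _; apply: sumr_ge0 => W' _; rewrite /few ler0n.
  by lra.
rewrite expect_sum.
apply: (@le_trans _ _ (\sum_(S : {set V}) \sum_(W : {set V}) expR (- 4) ^+ #|V|)).
  apply: ler_sum => S _; rewrite expect_sum; apply: ler_sum => W _.
  have [/andP[SW big]|no] := boolP ([disjoint S & W] && (16 * n <= q * #|S|%:R * #|W|%:R));
      last first.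
    have -> : Ex (few S W) = Ex (fun=> 0).
      by apply: eq_expect => E _; rewrite /few andbA (negbTE no).
    by rewrite expect_cst// exprn_ge0// expR_ge0.
  have KU : between S W \subset vpairs V.
    apply/subsetP => _ /imsetP[[u v]] /setXP[/= uS vW] ->; rewrite inE cards2.
    case: (eqVneq u v) => // uv; rewrite -uv in vW.
    by have /pred0P/(_ u) := SW; rewrite /= uS vW.
  have -> : Ex (few S W) =
      Ex (fun E => (#|E :&: between S W|%:R <= q * #|between S W|%:R / 4)%R%:R).
    apply: eq_expect => E _; rewrite /few SW big card_between//= natrM.
    by congr (nat_of_bool (_ <= _))%:R; lra.
  apply: le_trans (expect_few_le q0' q1 KU) _.
  rewrite -expRM_natl ler_expR card_between// natrM; lra.
rewrite !sumr_const -mulrnA -[leLHS]mulr_natl.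
have -> : #|{: {set V}}| = (2 ^ #|V|)%N.
  by rewrite -cardsT -card_powerset; apply: eq_card => S; rewrite !inE subsetT.
have e4 : expR (- 4) <= 16^-1 :> R.
  rewrite expRN lef_pV2 ?posrE ?expR_gt0//.
  have -> : (4 : R) = 4%:R * 1 by rewrite mulr1.
  rewrite expRM_natl (_ : 16 = 2 ^+ 4); last by rewrite -natrX.
  by apply: lerXn2r; rewrite ?nnegrE ?expR_ge0//; have := @expR_ge1Dx R 1; lra.
rewrite -expnMn natrX -exprMn; apply: lerXn2r; rewrite ?nnegrE ?mulr_ge0 ?expR_ge0//.
by lra.
Qed.

End LayerMoments.

(** * Typical graphs *)

Section RealBounds.
Variable R : realType.
Implicit Types (x y c eta L : R).

Lemma expR_ge_sqr x : 0 <= x -> x ^+ 2 / 2 <= expR x.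
Proof.
by move=> x0; have := @expR_ge1Dxn R x 1 x0; rewrite (_ : 2`!%:R = 2)//; lra.
Qed.

Lemma mul_expRN_le1 x : x * expR (- x) <= 1.
Proof.
rewrite expRN ler_pdivrMr ?expR_gt0// mul1r.
by have := @expR_ge1Dx R x; lra.
Qed.

(** As x e^(-x) <= 1, only the relative difference of the exponents matters. This is needed because
    ln (1 / lambda_n) is unbounded in general and layer sizes are known up to a relative error. *)
Lemma expRN_diff x y : x <= y -> 0 <= x -> y <= 2 * x ->
  0 <= expR (- x) - expR (- y) <= 2 * ((y - x) / y).
Proof.
move=> xy x0 yx; rewrite subr_ge0 ler_expR lerN2 xy/=.
have [y0|y0] := eqVneq y 0.
  have -> : x = 0 by lra.
  by rewrite y0 !subrr mul0r mulr0.
have yp : 0 < y by rewrite lt_neqAle eq_sym y0/=; lra.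
have h1 : expR (- x) - expR (- y) <= (y - x) * expR (- x).
  have : 0 <= expR (- x) * (expR (x - y) - (1 + (x - y))).
    by rewrite mulr_ge0 ?expR_ge0// subr_ge0 expR_ge1Dx.
  by rewrite mulrBr -expRD addrA addNr sub0r; lra.
apply: le_trans h1 _; rewrite mulrA ler_pdivlMr//.
have : (y - x) * (x * expR (- x)) <= (y - x) * 1.
  by rewrite ler_wpM2l ?subr_ge0 ?mul_expRN_le1.
have : 0 <= (y - x) * ((2 * x - y) * expR (- x)).
  by rewrite !mulr_ge0 ?expR_ge0// subr_ge0.
by lra.
Qed.

Lemma expr_1B_le (q : R) (N : nat) : 0 <= q <= 1 ->
  (1 - q) ^+ N <= expR (- (q * N%:R)).
Proof.
move=> /andP[q0 q1]; rewrite -mulNr mulrC expRM_natl.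
apply: lerXn2r; rewrite ?nnegrE ?expR_ge0//; first by lra.
exact: expR_ge1Dx.
Qed.

Lemma expr_1B_ge (q : R) (N : nat) : 0 <= q <= 2^-1 ->
  expR (- ((1 + 2 * q) * (q * N%:R))) <= (1 - q) ^+ N.
Proof.
move=> /andP[q0 q1]; rewrite mulrA -mulNr mulrC expRM_natl.
apply: lerXn2r; rewrite ?nnegrE ?expR_ge0//; first by lra.
rewrite expRN -[leRHS]invrK lef_pV2 ?posrE ?invr_gt0 ?expR_gt0//; last by lra.
apply: le_trans (expR_ge1Dx _).
have p1 : 0 < 1 - q by lra.
rewrite -[leLHS]mul1r ler_pdivrMr//.
have : 0 <= q ^+ 2 * (1 - 2 * q) by rewrite mulr_ge0 ?sqr_ge0//; lra.
by lra.
Qed.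

(* The fraction of vertices missed by a set whose size is close to c / q. *)
Lemma expr_1B_approx (q eta c : R) (N : nat) : 0 < q -> q <= eta ->
  eta <= 1 / 16 -> 0 <= c -> (1 - eta) * c <= q * N%:R <= (1 + eta) * c ->
  `|(1 - q) ^+ N - expR (- c)| <= 8 * eta.
Proof.
move=> q0 qeta eta16 c0 /andP[lo hi]; have eta0 : 0 < eta by lra.
have ec : 0 <= eta * c by rewrite mulr_ge0// ltW.
have up : (1 - q) ^+ N <= expR (- ((1 - eta) * c)).
  apply: le_trans (expr_1B_le _ _) _; first by lra.
  by rewrite ler_expR lerN2.
have dn : expR (- ((1 + 4 * eta) * c)) <= (1 - q) ^+ N.
  apply: le_trans (expr_1B_ge _ _); last by lra.
  rewrite ler_expR lerN2.
  have h1 : (1 + 2 * q) * (q * N%:R) <= (1 + 2 * eta) * ((1 + eta) * c).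
    by apply: ler_pM => //; try lra; rewrite mulr_ge0// ltW.
  apply: le_trans h1 _.
  have : 0 <= (1 - 2 * eta) * (eta * c) by rewrite mulr_ge0//; lra.
  by lra.
have [c00|cn0] := eqVneq c 0.
  rewrite c00 !mulr0 in up dn *.
  by rewrite ler_norml; lra.
have cp : 0 < c by rewrite lt_neqAle eq_sym cn0.
have etac : 0 <= c * (1 - 4 * eta) by rewrite mulr_ge0//; lra.
have /andP[_ d1] : 0 <= expR (- ((1 - eta) * c)) - expR (- c) <=
    2 * ((c - (1 - eta) * c) / c).
  have p0 : 0 <= (1 - eta) * c by lra.
  by apply: expRN_diff => //; lra.
have /andP[_ d2] : 0 <= expR (- c) - expR (- ((1 + 4 * eta) * c)) <=
    2 * (((1 + 4 * eta) * c - c) / ((1 + 4 * eta) * c)).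
  by apply: expRN_diff => //; lra.
have e1 : (c - (1 - eta) * c) / c = eta by field.
have e2 : ((1 + 4 * eta) * c - c) / ((1 + 4 * eta) * c) <= 4 * eta.
  rewrite ler_pdivrMr; last by rewrite mulr_gt0//; lra.
  have : 0 <= eta * (eta * c) by rewrite mulr_ge0// ltW.
  by lra.
by rewrite e1 in d1; rewrite ler_norml; lra.
Qed.

(** The bound x^2 / 2 <= e^x at x = eta L gives 16 L <= e^(eta L). *)
Lemma ln_le_small eta L : 0 < eta -> eta <= 1 / 16 -> 32 / eta ^+ 2 <= L ->
  [/\ 1 <= eta * L, ln L <= eta * L & 32 / eta <= expR (eta * L)].
Proof.
move=> eta0 eta16 LB.
have e2 : 0 < eta ^+ 2 by rewrite exprn_gt0.
have h : 32 <= L * eta ^+ 2 by rewrite -ler_pdivrMr.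
have L0 : 0 < L by apply: lt_le_trans LB; rewrite divr_gt0.
have h' : 32 <= eta * L.
  apply: le_trans h _.
  have eL : 0 <= eta * L by rewrite mulr_ge0// ltW.
  have : 0 <= (eta * L) * (1 - eta) by apply: mulr_ge0 => //; lra.
  by lra.
split; first by lra.
  rewrite -ler_expR lnK ?posrE//.
  apply: le_trans (expR_ge_sqr _); last by lra.
  have : 0 <= L * (L * eta ^+ 2 - 32) by apply: mulr_ge0; rewrite ?subr_ge0// ltW.
  by lra.
apply: le_trans (expR_ge1Dx _).
rewrite ler_pdivrMr//; lra.
Qed.

End RealBounds.

Section Typical.
Variables (R : realType) (V : finType) (r : V).
Implicit Types (q L eta Delta lambda : R) (k : nat) (E : {set {set V}}).
Local Notation n := (#|V|%:R : R).

Definition sparse_pair q E : bool := [exists S : {set V},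
  16 * n <= q * #|S|%:R * #|low_degree E S (q * #|S|%:R / 4)|%:R].

(** Here k = d - 1. Layer d may have only about n / L^2 vertices, which sets the scale of its
    allowed fluctuation. The factor L in the bounds on parents and degrees is the price of Markov's
    inequality; it is harmless since ln L is small compared with L. *)
Definition typical q L eta k E : bool :=
  [&& `|#|layer E r k|%:R - (n * q) ^+ k| <= eta * (n * q) ^+ k,
      #|inner E r k.+1|%:R <= eta * n,
      `|#|layer E r k.+1|%:R - step_mean r q k E| <= eta * (n / L ^+ 2),
      (parent_sum E r k.+2)%:R <= L * (n * q) ^+ k.+1,
      (degree_sum E)%:R <= L * (n * (n * q)) &
      ~~ sparse_pair q E].

(** Chebyshev's inequality for the two conditions on single layers, Markov's for the explored set,
    the parents and the degrees, and the union bound for the last condition. *)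
Lemma expect_atypical q L eta k : 0 < q -> q < 1 -> 2 <= n * q ->
  0 < L -> 0 < eta ->
  expect (vpairs V) q (fun E => (~~ typical q L eta k E)%:R) <=
  ((n * q - 1)^-1 + 16 * ((n * q) ^+ k / n)) / eta ^+ 2
  + 2 * ((n * q) ^+ k / n) / eta + (n * q) ^+ k.+1 / (eta * (n / L ^+ 2)) ^+ 2
  + 2 / L + L^-1 + 4^-1 ^+ #|V|.
Proof.
move=> q0 q1 m2 L0 eta0; set m := n * q in m2 *; have q0' := ltW q0.
have m0 : 0 < m by lra.
have n0 : 0 < n by rewrite -(pmulr_lgt0 _ q0).
have mk0 j : 0 < m ^+ j by rewrite exprn_gt0.
pose A1 E := ~~ (`|#|layer E r k|%:R - m ^+ k| <= eta * m ^+ k).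
pose A2 E := ~~ (#|inner E r k.+1|%:R <= eta * n).
pose A3 E := ~~ (`|#|layer E r k.+1|%:R - step_mean r q k E| <= eta * (n / L ^+ 2)).
pose A4 E := ~~ ((parent_sum E r k.+2)%:R <= L * m ^+ k.+1).
pose A5 E := ~~ ((degree_sum E)%:R <= L * (n * m)).
apply: (@le_trans _ _ (expect (vpairs V) q (fun E => (A1 E)%:R + (A2 E)%:R +
    (A3 E)%:R + (A4 E)%:R + (A5 E)%:R + (sparse_pair q E)%:R))).
  apply: ler_expect => // E _; rewrite -!natrD ler_nat /typical !negb_and negbK.
  rewrite -/m -/(A1 E) -/(A2 E) -/(A3 E) -/(A4 E) -/(A5 E).
  by case: (A1 E); case: (A2 E); case: (A3 E); case: (A4 E); case: (A5 E);
    case: (sparse_pair q E).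
rewrite !expectD.
have markov2 (f : {set {set V}} -> R) (a p : R) : 0 < a ->
    expect (vpairs V) q (fun E => f E ^+ 2) <= a ^+ 2 * p ->
    expect (vpairs V) q (fun E => (~~ (`|f E| <= a))%:R) <= p.
  move=> a0; apply: expect_markov => //; first by rewrite exprn_gt0.
    by move=> E _; exact: sqr_ge0.
  move=> E _; rewrite -ltNge => lt; rewrite -[leRHS]real_normK ?num_real//.
  by apply: lerXn2r; rewrite ?nnegrE// ltW.
have markov1 (f : {set {set V}} -> R) (a p : R) : 0 < a ->
    (forall E, 0 <= f E) -> expect (vpairs V) q f <= a * p ->
    expect (vpairs V) q (fun E => (~~ (f E <= a))%:R) <= p.
  move=> a0 f0; apply: expect_markov => //.
  by move=> E _; rewrite -ltNge => /ltW.
have nz := lt0r_neq0.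
have eta_n0 : eta != 0 by rewrite nz.
have n_n0 : n != 0 by rewrite nz.
have L_n0 : L != 0 by rewrite nz.
apply: (lerD (lerD (lerD (lerD (lerD _ _) _) _) _) _).
- apply: markov2; first by rewrite mulr_gt0.
  apply: le_trans (layer_variance r q0 q1 m2 k) _; rewrite -/m.
  move: (_ + 16 * _) => A.
  by rewrite le_eqVlt; apply/orP; left; apply/eqP; field.
- apply: markov1; first by rewrite mulr_gt0.
    by move=> E; exact: ler0n.
  apply: le_trans (expect_inner_le r q0 q1 m2 k) _; rewrite -/m.
  by rewrite le_eqVlt; apply/orP; left; apply/eqP; field; rewrite eta_n0 n_n0.
- have a0 : 0 < eta * (n / L ^+ 2) by rewrite mulr_gt0 ?divr_gt0 ?exprn_gt0.
  apply: markov2 => //; apply: le_trans (layerS_var r q0 q1 m2 k) _; rewrite -/m.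
  by rewrite [leRHS]mulrC divfK// expf_neq0// nz.
- apply: markov1; first by rewrite mulr_gt0.
    by move=> E; exact: ler0n.
  apply: le_trans (expect_parent_sum r q0 q1 m2 k.+1) _; rewrite -/m.
  by rewrite le_eqVlt; apply/orP; left; apply/eqP; field.
- apply: markov1; first by rewrite !mulr_gt0.
    by move=> E; exact: ler0n.
  apply: le_trans (expect_degree_sum V q0 q1) _; rewrite -/m.
  by rewrite le_eqVlt; apply/orP; left; apply/eqP; field.
- exact: expect_low_degree.
Qed.

(* Here k + 1 stands for d_n^* and (n * q) ^+ k.+1 / n for ln (1 / lambda_n). *)
Record regime q L eta Delta lambda k : Prop := Regime {
  regime_eta0 : 0 < eta;
  regime_eta : eta <= 1 / 16;
  regime_L : 32 / eta ^+ 2 <= L;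
  regime_q0 : 0 < q;
  regime_mean : `|ln (n * q) - L| <= eta * L;
  regime_last : `|ln ((n * q) ^+ k.+1 / n) - Delta * L| <= eta * L;
  regime_lambda : `|expR (- ((n * q) ^+ k.+1 / n)) - lambda| <= eta;
  regime_last_ge : 1 / L ^+ 2 <= (n * q) ^+ k.+1 / n;
  regime_prev_le : (n * q) ^+ k <= n / L ^+ 2;
  regime_sparse : n * q * L ^+ 3 <= n }.

Section Estimates.
Variables (q L eta Delta lambda : R) (k : nat) (E : {set {set V}}).
Hypothesis reg : regime q L eta Delta lambda k.
Hypothesis typ : typical q L eta k E.
Local Notation m := (n * q).
Local Notation c := (m ^+ k.+1 / n).
Local Notation N1 := (#|layer E r k.+1|%:R : R).

Lemma regime_basic : [/\ 0 < n, 1 <= L, 1 <= eta * L, ln L <= eta * L &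
  [/\ 32 / eta <= expR (eta * L), q <= eta, 0 < c, 0 < m & q * m ^+ k = c]].
Proof.
case: reg => eta0 eta16 LB q0 _ _ _ _ _ sp.
have [eL lnL eeL] := ln_le_small eta0 eta16 LB.
have n0 : 0 < n by rewrite ltr0n; apply/card_gt0P; exists r.
have L1 : 1 <= L.
  apply: le_trans LB; rewrite ler_pdivlMr ?exprn_gt0// mul1r.
  have : 0 <= eta * (1 - eta) by apply: mulr_ge0; lra.
  by lra.
have m0 : 0 < m by rewrite mulr_gt0.
split=> //; split=> //.
- have qL : q * L ^+ 3 <= 1.
    by rewrite -(ler_pM2l n0) mulr1 mulrA.
  have qL' : q * L <= 1.
    apply: le_trans qL; apply: ler_wpM2l; first exact: ltW.
    have : 0 <= L * (L ^+ 2 - 1).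
      rewrite mulr_ge0//; first by lra.
      by rewrite subr_ge0 exprn_ege1.
    by lra.
  have : 0 <= q * (eta * L - 1) by rewrite mulr_ge0 ?subr_ge0// ltW.
  have : 0 <= eta * (1 - q * L) by rewrite mulr_ge0 ?subr_ge0// ltW.
  by lra.
- by rewrite divr_gt0 ?exprn_gt0.
- by rewrite exprS; field; rewrite lt0r_neq0.
Qed.

Lemma qlayer_bounds :
  (1 - eta) * c <= q * #|layer E r k|%:R <= (1 + eta) * c.
Proof.
case: reg => _ _ _ q0 _ _ _ _ _ _.
have [_ _ _ _ [_ _ _ _ <-]] := regime_basic.
have /and5P[h _ _ _ _] := typ; move: h; rewrite ler_norml => /andP[h1 h2].
have := ler_wpM2l (ltW q0) h1; have := ler_wpM2l (ltW q0) h2.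
by move=> *; apply/andP; split; lra.
Qed.

(** A vertex outside the first layers misses layer d with probability close to e^(-c), as q m^k = c.
    The error is 8 eta from [expr_1B_approx] and one eta each from lambda, the explored vertices and
    the fluctuation. *)
Lemma layer_fraction : `|N1 - (1 - lambda) * n| <= 11 * eta * n.
Proof.
case: reg => eta0 eta16 _ q0 _ _ lam _ _ _.
have [n0 L1 _ _ [_ qeta c0 _ _]] := regime_basic.
have /and5P[_ inn h3 _ _] := typ.
have L2 : n / L ^+ 2 <= n.
  have L20 : 0 < L ^+ 2 by rewrite exprn_gt0//; lra.
  by rewrite ler_pdivrMr//; apply: ler_peMr; [exact: ltW|rewrite exprn_ege1].
have := expr_1B_approx q0 qeta eta16 (ltW c0) qlayer_bounds.
set rho := (1 - q) ^+ _ => rhoP.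
have rho01 : 0 <= rho <= 1.
  by rewrite exprn_ge0 ?exprn_ile1//; lra.
have i0 : 0 <= #|inner E r k.+1|%:R :> R by [].
have sm : `|step_mean r q k E - (1 - lambda) * n| <= 10 * eta * n.
  rewrite /step_mean -/rho; set i := #|_|%:R in i0 inn *.
  have rl : `|rho - lambda| <= 9 * eta.
    by move: rhoP lam; rewrite !ler_norml; lra.
  have a1 : 0 <= i * (1 - rho) by rewrite mulr_ge0//; lra.
  have a2 : 0 <= i * rho by rewrite mulr_ge0//; lra.
  have /andP[a3 a4] : - (9 * eta * n) <= (rho - lambda) * n <= 9 * eta * n.
    rewrite -ler_norml normrM [`|n|]ger0_norm//.
    by rewrite ler_wpM2r.
  by rewrite ler_norml; apply/andP; split; lra.
have eL2 := ler_wpM2l (ltW eta0) L2.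
by move: sm h3; rewrite !ler_norml => /andP[? ?] /andP[? ?]; apply/andP; split; lra.
Qed.

(** For lambda close to 1 [layer_fraction] gives no lower bound, but c >= 1 / L^2 does. A loss of
    L^2 is affordable, since degrees into the layer enter through their logarithms. *)
Lemma layer_large : n / (8 * L ^+ 2) <= N1.
Proof.
case: reg => eta0 eta16 _ q0 _ _ _ cL _ _.
have [n0 L1 _ _ [_ qeta c0 _ _]] := regime_basic.
have /and5P[_ inn h3 _ _] := typ.
have /andP[qlo _] := qlayer_bounds.
set x := 1 / L ^+ 2 in cL *.
have L20 : 0 < L ^+ 2 by rewrite exprn_gt0//; lra.
have x0 : 0 < x by rewrite divr_gt0.
have x1 : x <= 1 by rewrite ler_pdivrMr// mul1r exprn_ege1.
have Ln0 : L != 0 by rewrite gt_eqF//; lra.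
have e1 : n / (8 * L ^+ 2) = n * x / 8 by rewrite /x; field.
have e2 : n / L ^+ 2 = n * x by rewrite /x; field.
rewrite e1; rewrite e2 in h3.
set y := q * _ in qlo; set rho := (1 - q) ^+ #|layer E r k|.
have y2 : x / 2 <= y.
  have : 0 <= (1 / 2 - eta) * (c - x) by apply: mulr_ge0; lra.
  have : 0 <= (1 / 2 - eta) * x by apply: mulr_ge0; lra.
  by lra.
have rho_le : rho <= expR (- (x / 2)).
  apply: le_trans (expr_1B_le _ _) _; first by apply/andP; split; lra.
  by rewrite ler_expR lerN2.
have esc : x / 4 <= 1 - rho.
  have : expR (- (x / 2)) <= (1 + x / 2)^-1.
    rewrite expRN lef_pV2 ?posrE ?expR_gt0 ?expR_ge1Dx//.
    by lra.
  have : (1 + x / 2)^-1 <= 1 - x / 4.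
    rewrite -[leLHS]mul1r ler_pdivrMr; last by lra.
    have : 0 <= x * (1 - x / 2) by apply: mulr_ge0; lra.
    by lra.
  by lra.
have sm : 3 / 16 * (n * x) <= step_mean r q k E.
  rewrite /step_mean -/rho.
  apply: (@le_trans _ _ ((15 / 16 * n) * (x / 4))).
    have : 0 <= n * x by rewrite mulr_ge0// ltW.
    by lra.
  have : 0 <= (1 / 16 - eta) * n by apply: mulr_ge0; lra.
  move=> en; apply: ler_pM => //; lra.
have : 0 <= (1 / 16 - eta) * (n * x).
  by apply: mulr_ge0; [lra|rewrite mulr_ge0// ltW].
by move: h3; rewrite ler_norml => /andP[? ?]; lra.
Qed.

Lemma low_degree_small (S : {set V}) : 0 < #|S|%:R :> R ->
  #|low_degree E S (q * #|S|%:R / 4)|%:R * (q * #|S|%:R) <= 16 * n.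
Proof.
move=> S0; have /and5P[_ _ _ _ /andP[_ /existsPn/(_ S)]] := typ.
by rewrite -ltNge => /ltW; rewrite mulrC.
Qed.

(** Since t >= m / (32 L^2), passing from L to ln t costs eta L for the mean degree, eta L for ln 32
    and 2 eta L for ln (L^2). *)
Lemma large_set (S : {set V}) (t := q * #|S|%:R / 4) :
  n / (8 * L ^+ 2) <= #|S|%:R ->
  [/\ 1 <= t, (1 - 4 * eta) * L <= ln t & #|low_degree E S t|%:R <= eta * n].
Proof.
move=> SL; case: reg => eta0 eta16 _ q0 mean _ _ _ _ _.
have [n0 L1 eL lnL [eeL qeta c0 m0 _]] := regime_basic.
have L0 : 0 < L by lra.
have S0 : 0 < #|S|%:R :> R.
  by apply: lt_le_trans SL; rewrite divr_gt0 ?mulr_gt0 ?exprn_gt0.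
have t0 : 0 < t by rewrite /t divr_gt0 ?mulr_gt0.
have tge : m / (32 * L ^+ 2) <= t.
  have := ler_wpM2l (ltW q0) SL; rewrite /t => h.
  have -> : m / (32 * L ^+ 2) = q * (n / (8 * L ^+ 2)) / 4.
    by field; rewrite lt0r_neq0.
  by lra.
have ln32 : ln 32 <= eta * L :> R.
  rewrite -ler_expR lnK ?posrE//; apply: le_trans eeL.
  rewrite ler_pdivlMr//; lra.
have lnt : (1 - 4 * eta) * L <= ln t.
  apply: (@le_trans _ _ (ln (m / (32 * L ^+ 2)))); last first.
    by rewrite ler_ln ?posrE// divr_gt0 ?mulr_gt0 ?exprn_gt0.
  rewrite ln_div ?posrE ?mulr_gt0 ?exprn_gt0// [ln (32 * _)]lnM ?posrE ?exprn_gt0//.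
  rewrite lnXn// mulr2n.
  by move: mean; rewrite ler_norml => /andP[? ?]; lra.
have pos : eta * L <= (1 - 4 * eta) * L.
  by apply: ler_wpM2r; lra.
have t32 : 32 / eta <= t.
  apply: le_trans eeL _; rewrite -[leRHS]lnK ?posrE// ler_expR.
  exact: le_trans pos lnt.
have t1 : 1 <= t.
  apply: le_trans t32; rewrite ler_pdivlMr//; lra.
split=> //.
have low := low_degree_small S0; rewrite -/t in low.
rewrite -(ler_pM2r t0).
have : 32 <= t * eta by rewrite -ler_pdivrMr.
move=> te; have := ler_wpM2r (ltW n0) te.
have e4 : q * #|S|%:R = t * 4 by rewrite /t; lra.
by move: low; rewrite e4; lra.
Qed.

End Estimates.
End Typical.

Lemma subset_of_card (V : finType) (A : {set V}) (s : nat) : (s <= #|A|)%N ->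
  exists2 S : {set V}, S \subset A & #|S| = s.
Proof.
move=> sA; exists [set x in take s (enum A)].
  by apply/subsetP => x; rewrite inE => /mem_take; rewrite mem_enum.
rewrite cardsE; have /card_uniqP -> : uniq (take s (enum A)).
  by rewrite take_uniq// enum_uniq.
by rewrite size_takel// -cardE.
Qed.

(** * The partition function of a typical graph *)

Section FreeEnergyBounds.
Variables (R : realType) (V : finType) (r : V).
Variables (q L eta Delta lambda beta : R) (k : nat) (E : {set {set V}}).
Hypothesis reg : regime V q L eta Delta lambda k.
Hypothesis typ : typical r q L eta k E.
Hypothesis simpleE : E \subset vpairs V.
Hypotheses (Delta01 : 0 <= Delta <= 1) (lambda01 : 0 <= lambda <= 1).
Hypothesis beta0 : 0 < beta.
Local Notation n := (#|V|%:R : R).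
Local Notation m := (n * q).
Local Notation c := (m ^+ k.+1 / n).
Local Notation W := (log_excess E r (beta * L)).

Let basic := regime_basic r reg.

Let b0 : 0 <= beta * L.
Proof.
have [_ L1 _ _ _] := basic; have bt := beta0.
by apply: mulr_ge0; lra.
Qed.

Let inner_le_eta : #|inner E r k.+1|%:R <= eta * n.
Proof. by have /and5P[] := typ. Qed.

Let N1P : (1 - lambda - 11 * eta) * n <= #|layer E r k.+1|%:R <=
  (1 - lambda + 11 * eta) * n.
Proof.
have := layer_fraction reg typ; rewrite ler_norml => /andP[? ?].
by apply/andP; split; lra.
Qed.

Lemma log_excess_le_typical (mu := Num.max Delta (1 - beta)) :
  W <= (lambda + (1 - lambda) * mu + 17 * eta) * (n * L).
Proof.
case: reg => eta0 eta16 _ q0 mean last _ _ _ _.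
have [n0 L1 eL lnL [_ _ c0 m0 _]] := basic.
have bt := beta0.
have muD : Delta <= mu by rewrite le_max lexx.
have mub : 1 - beta <= mu by rewrite le_max lexx orbT.
have mu1 : mu <= 1 by rewrite ge_max; apply/andP; split; [case/andP: Delta01|lra].
have mu0 : 0 <= mu by apply: le_trans muD; case/andP: Delta01.
have /and5P[_ _ _ ps /andP[ds _]] := typ.
have L0 : 0 < L by lra.
have eLL : 0 <= eta * L by lra.
(* Tangent points for layers up to d and for the others; of the 2 eta, one absorbs ln L and one the
   error in ln c or ln m. The two tangent terms are at most 2 n each, so 4 eta n L together, and 17
   = 11 + 2 + 4 with 11 from [layer_fraction]. *)
pose t1 := expR ((mu + 2 * eta) * L); pose t2 := expR ((1 + 2 * eta) * L).
have ge1 x : 0 <= x -> 1 <= expR (x * L).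
  by move=> x0; apply: le_trans (expR_ge1Dx _); rewrite lerDl mulr_ge0// ltW.
have t11 : 1 <= t1 by apply: ge1; lra.
have t21 : 1 <= t2 by apply: ge1; lra.
have mean' : ln m <= (1 + eta) * L by move: mean; rewrite ler_norml; lra.
have last' : ln c <= (Delta + eta) * L by move: last; rewrite ler_norml; lra.
have Lc : L * c <= t1.
  have -> : L * c = expR (ln L + ln c) by rewrite expRD !lnK.
  rewrite ler_expR; have : 0 <= (mu - Delta) * L by apply: mulr_ge0; lra.
  by lra.
have Lm : L * m <= t2.
  have -> : L * m = expR (ln L + ln m) by rewrite expRD !lnK.
  by rewrite ler_expR; lra.
have Lmb : L * m * expR (- (beta * L)) <= t1.
  have -> : L * m * expR (- (beta * L)) = expR (ln L + ln m - beta * L).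
    by rewrite !expRD !lnK.
  rewrite ler_expR; have : 0 <= (mu - (1 - beta)) * L by apply: mulr_ge0; lra.
  by lra.
apply: le_trans (log_excess_le_split r simpleE b0 k.+2 t11 t21) _.
rewrite !expRK card_innerS natrD.
set B : R := #|inner E r k.+1|%:R + #|layer E r k.+1|%:R.
have s1 : ((parent_sum E r k.+2)%:R + (degree_sum E)%:R * expR (- (beta * L))) / t1
    <= 2 * n.
  rewrite ler_pdivrMr; last by lra.
  have h1 := ler_wpM2r (expR_ge0 (- (beta * L))) ds.
  have h2 := ler_wpM2l (ltW n0) Lc; have h3 := ler_wpM2l (ltW n0) Lmb.
  have e : n * (L * c) = L * m ^+ k.+1 by field; rewrite lt0r_neq0.
  rewrite e in h2.
  move: ps h1 h2 h3; move: (m ^+ k.+1) (expR _) => x y; lra.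
have s2 : 2 * (degree_sum E)%:R / t2 <= 2 * n.
  rewrite ler_pdivrMr; last by lra.
  by have h3 := ler_wpM2l (ltW n0) Lm; move: ds h3; lra.
have BP : (1 - lambda - 11 * eta) * n <= B.
  rewrite /B; have /andP[h _] := N1P; have : 0 <= #|inner E r k.+1|%:R :> R by [].
  by move: h; lra.
move: s1 s2; move: (_ / t1) (_ / t2) => x y s1 s2.
have h1 : 0 <= (B - (1 - lambda - 11 * eta) * n) * ((1 - mu) * L).
  by rewrite mulr_ge0 ?subr_ge0// mulr_ge0 ?subr_ge0// ltW.
have h2 : 0 <= eta * n * L * mu by rewrite !mulr_ge0// ltW.
have h3 : 0 <= (eta * L - 1) * n by rewrite mulr_ge0 ?subr_ge0.
by move: h1 h2 h3 s1 s2; move: (n) => N; lra.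
Qed.

Lemma log_excess_ge0 : 0 <= W.
Proof.
have := log_excess_ge_bfs E r b0 0 (lexx 1).
by rewrite ln1 mulr0.
Qed.

(** When Delta exceeds the error, c is large, so almost every vertex has at least c / 8 neighbours
    in layer d - 1, where ln c is about Delta L. Otherwise [log_excess_ge0] suffices. *)
Lemma log_excess_ge_Delta : (Delta - 5 * eta) * (n * L) <= W.
Proof.
case: reg => eta0 eta16 _ q0 _ last _ _ _ _.
have [n0 L1 eL lnL [eeL _ c0 m0 _]] := basic; have D01 := Delta01.
have nL0 : 0 <= n * L by apply: mulr_ge0; lra.
move: c c0 last (qlayer_bounds reg typ) => c c0 last /andP[qlo _].
have [small|big] := lerP (Delta - 5 * eta) 0.
  by apply: le_trans log_excess_ge0; exact: mulr_le0_ge0.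
pose S := layer E r k; pose t := q * #|S|%:R / 4.
have last' : (Delta - eta) * L <= ln c by move: last; rewrite ler_norml; lra.
have c32 : 32 / eta <= c.
  apply: le_trans eeL _; rewrite -[leRHS]lnK ?posrE// ler_expR.
  apply: le_trans last'; apply: ler_wpM2r; lra.
have c32' : 32 <= c * eta by rewrite -ler_pdivrMr.
have c2 : c / 2 <= q * #|S|%:R.
  apply: le_trans qlo; have : 0 <= (1 / 2 - eta) * c by apply: mulr_ge0; lra.
  by lra.
have c512 : 512 <= c.
  have : 0 <= c * (1 / 16 - eta) by apply: mulr_ge0; lra.
  by lra.
have t8 : c / 8 <= t by rewrite /t; lra.
have t1 : 1 <= t by lra.
have S0 : 0 < #|S|%:R :> R by rewrite -(pmulr_rgt0 _ q0); lra.
have ln8 : ln 8 <= eta * L :> R.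
  rewrite -ler_expR lnK ?posrE//; apply: le_trans eeL.
  rewrite ler_pdivlMr//; lra.
have lnt : (Delta - 2 * eta) * L <= ln t.
  apply: (@le_trans _ _ (ln (c / 8))); last by rewrite ler_ln ?posrE//; lra.
  by rewrite ln_div ?posrE//; lra.
have low : #|low_degree E S t|%:R <= eta * n.
  have := low_degree_small typ S0; rewrite -/t => h.
  have c0' : 0 < c / 2 by lra.
  rewrite -(ler_pM2r c0'); apply: (@le_trans _ _ (16 * n)).
    by apply: le_trans h; rewrite ler_wpM2l.
  by have := ler_wpM2l (ltW n0) c32'; lra.
apply: le_trans (log_excess_ge_bfs E r b0 k t1).
apply: (@le_trans _ _ (((1 - 2 * eta) * n) * ((Delta - 2 * eta) * L))).
  have : 0 <= eta * (n * L) * (1 - Delta) by apply: mulr_ge0; [apply: mulr_ge0|]; lra.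
  have : 0 <= eta * eta * (n * L) by apply: mulr_ge0 => //; rewrite mulr_ge0// ltW.
  have : 0 <= eta * (n * L) by apply: mulr_ge0 => //; exact: ltW.
  by lra.
apply: ler_pM => //.
- by rewrite mulr_ge0//; lra.
- by apply: mulr_ge0; lra.
- by rewrite natrD; move: inner_le_eta low; lra.
Qed.

(** About lambda n vertices lie beyond layer d, and almost all of them have about e^L parents in
    layer d; the entropy of the others is dropped. *)
Lemma log_excess_ge_lambda : (lambda - 17 * eta) * (n * L) <= W.
Proof.
case: reg => eta0 eta16 _ q0 _ _ _ _ _ _.
have [n0 L1 eL lnL _] := basic; have l01 := lambda01.
have nL0 : 0 <= n * L by apply: mulr_ge0; lra.
have [small|big] := lerP (lambda - 13 * eta) 0.
  apply: le_trans log_excess_ge0; apply: mulr_le0_ge0 => //; lra.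
have [t1 lnt low] := large_set reg typ (layer_large reg typ).
apply: le_trans (log_excess_ge_bfs E r b0 k.+1 t1).
apply: (@le_trans _ _ (((lambda - 13 * eta) * n) * ((1 - 4 * eta) * L))).
  have : 0 <= eta * (n * L) * (1 - lambda) by apply: mulr_ge0; [apply: mulr_ge0|]; lra.
  have : 0 <= eta * eta * (n * L) by apply: mulr_ge0 => //; rewrite mulr_ge0// ltW.
  by lra.
apply: ler_pM => //.
- by apply: mulr_ge0; lra.
- by apply: mulr_ge0; lra.
- have /andP[_ h] := N1P; rewrite natrD card_innerS natrD.
  by move: inner_le_eta low h; lra.
Qed.

Let eta_n_ge2 : 2 <= eta * n.
Proof.
case: reg => eta0 eta16 LB _ mean _ _ _ pk _.
have [n0 L1 eL _ [_ _ _ m0 _]] := basic.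
have L20 : 0 < L ^+ 2 by rewrite exprn_gt0//; lra.
have e20 : 0 < eta ^+ 2 by rewrite exprn_gt0.
have : 32 <= L * eta ^+ 2 by rewrite -ler_pdivrMr.
have : 0 <= L * (1 - eta ^+ 2).
  apply: mulr_ge0; first lra.
  by rewrite subr_ge0 exprn_ile1//; lra.
move=> h1 h2; have L32 : 2 <= L by lra.
have m1 : 1 <= m.
  rewrite leNgt; apply/negP => m1.
  have : ln m <= 0 by rewrite ln_le0// ltW.
  have : 0 <= (1 / 16 - eta) * L by apply: mulr_ge0; lra.
  by move: mean; rewrite ler_norml; lra.
have nL2 : L ^+ 2 <= n.
  rewrite -[leLHS]mul1r -ler_pdivlMr//; apply: le_trans pk.
  exact: exprn_ege1.
have h3 := ler_wpM2l (ltW eta0) nL2.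
have : 0 <= (eta * L - 1) * L by apply: mulr_ge0; lra.
by lra.
Qed.

(** Almost every vertex hangs below S and gains entropy about L; the (1 - lambda) n vertices of
    layer d pay beta L each for being lowered. *)
Lemma log_excess_ge_beta :
  (1 - beta * (1 - lambda) - (7 + 12 * beta) * eta) * (n * L) <= W.
Proof.
case: reg => eta0 eta16 _ q0 _ _ _ _ _ _.
have [n0 L1 eL _ _] := basic; have l01 := lambda01.
have bt := beta0.
have L0 : 0 < L by lra.
have L20 : 0 < L ^+ 2 by rewrite exprn_gt0.
have eL2 : 1 <= eta * L ^+ 2.
  have : 0 <= (eta * L - 1) * L by apply: mulr_ge0; lra.
  by lra.
(* S consists of about eta n vertices of layer d, or of the whole layer if it is smaller;
   [layer_large] keeps it large enough for [large_set]. *)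
pose s0 := Num.truncn (eta * n).
have /andP[s0lo s0hi] := truncn_itv (mulr_ge0 (ltW eta0) (ltW n0)).
rewrite -/s0 in s0lo s0hi.
have [S SL cS] := subset_of_card (geq_minl #|layer E r k.+1| s0).
have Sup : #|S|%:R <= eta * n.
  by rewrite cS; apply: le_trans s0lo; rewrite ler_nat geq_minr.
have Slo : n / (8 * L ^+ 2) <= #|S|%:R.
  rewrite cS natr_min le_min (layer_large reg typ)/=.
  rewrite ler_pdivrMr; last by rewrite mulr_gt0.
  move: s0hi; rewrite -natr1 => s0hi.
  have h8 := ler_wpM2r (ltW n0) eL2; have h1 := ler_wpM2r (ltW L20) (ltW s0hi).
  have h2 : 2 * L ^+ 2 <= eta * n * L ^+ 2.
    by apply: ler_wpM2r; [exact: ltW|exact: eta_n_ge2].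
  by move: n0 h8 h1 h2; move: (s0%:R) (n) (L ^+ 2) => x y z; lra.
have [t1 lnt low] := large_set reg typ Slo.
apply: le_trans (log_excess_ge_shift simpleE b0 t1 SL).
set X := _%:R in low *.
have /andP[_ N1hi] := N1P.
have h1 : ((1 - 3 * eta) * n) * ((1 - 4 * eta) * L) <=
    (n - (#|inner E r k.+1| + #|S| + #|low_degree E S (q * #|S|%:R / 4)|)%:R)
     * ln (q * #|S|%:R / 4).
  apply: ler_pM => //.
  - by apply: mulr_ge0; lra.
  - by apply: mulr_ge0; lra.
  - by rewrite !natrD; move: inner_le_eta low; lra.
have h2 : beta * L * (#|layer E r k.+1| + #|low_degree E S (q * #|S|%:R / 4)|)%:R
    <= beta * L * ((1 - lambda + 12 * eta) * n).
  by rewrite ler_wpM2l// natrD; lra.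
have h3 : 0 <= eta * eta * (n * L).
  by apply: mulr_ge0; rewrite mulr_ge0// ltW.
by move: h1 h2 h3; lra.
Qed.

(** For lambda = 0 the target is max (Delta, 1 - beta), for Delta = 0 it is max (lambda, 1 - beta (1
    - lambda)), so one of the three lower bounds always meets the upper bound. *)
Lemma log_excess_typical : lambda = 0 \/ Delta = 0 ->
  `|W - (lambda + (1 - lambda) * Num.max Delta (1 - beta)) * (n * L)| <=
  (20 + 20 * beta) * eta * (n * L).
Proof.
move=> lD; case: reg => eta0 _ _ _ _ _ _ _ _ _.
have [n0 L1 _ _ _] := basic; have l01 := lambda01; have bt := beta0.
have nL : 0 <= n * L by apply: mulr_ge0; lra.
have up : W <= (lambda + (1 - lambda) * Num.max Delta (1 - beta) + 17 * eta) * (n * L).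
  exact: log_excess_le_typical.
have h1 := log_excess_ge_Delta; have h2 := log_excess_ge_lambda.
have h3 := log_excess_ge_beta.
move: nL up h1 h2 h3; move: (n * L) W => x w x0 up h1 h2 h3.
have p1 : 0 <= eta * x by rewrite mulr_ge0// ltW.
have p2 : 0 <= beta * (eta * x) by rewrite mulr_ge0// ltW.
rewrite ler_norml; apply/andP; split; last first.
  by move: (Num.max _ _) up => y up; lra.
by case: (lerP Delta) => _; case: lD => e; rewrite e in h1 h2 h3 *; lra.
Qed.

End FreeEnergyBounds.

(** * Asymptotics *)

Local Open Scope classical_set_scope.

(** Used with x = Delta_n and y = ln m, whose product is the logarithm of m^d / n. *)
Lemma dist_mul_le (R : realType) (x y D L eta : R) : 0 <= D <= 1 ->
  `|D - x| <= eta / 4 -> `|y - L| <= eta / 8 * L -> 0 <= y <= 2 * L ->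
  `|x * y - D * L| <= eta * L.
Proof.
move=> /andP[D0 D1] Dx yL /andP[y0 y2].
have -> : x * y - D * L = (x - D) * y + D * (y - L) by ring.
apply: le_trans (ler_normD _ _) _; rewrite !normrM.
have h1 : `|x - D| * `|y| <= eta / 4 * (2 * L).
  by apply: ler_pM => //; [rewrite distrC|rewrite ger0_norm].
have h2 : `|D| * `|y - L| <= 1 * (eta / 8 * L).
  by apply: ler_pM => //; rewrite ger0_norm.
have : 0 <= eta / 8 * L by exact: le_trans yL.
by lra.
Qed.

Section Asymptotics.
Variables (R : realType) (alpha : nat -> R).
Hypothesis alpha_gt0 : forall n, 0 < alpha n.

Lemma limn_esup_ltP (u : nat -> R) (x : \bar R) :
  (limn_esup (fun n => (u n)%:E) < x)%E ->
  exists2 y : \bar R, (y < x)%E & \forall n \near \oo, ((u n)%:E <= y)%E.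
Proof.
move=> /ereal_inf_lt[_ [A Aoo <-] supA]; exists (ereal_sup ((fun n => (u n)%:E) @` A)) => //.
move: Aoo; apply: filterS => n An; apply: ereal_sup_ubound.
by exists n.
Qed.

Lemma alpha_bounded :
  (0 < limn_einf (fun n => (alpha n)%:E))%E ->
  (limn_esup (fun n => (alpha n)%:E) < +oo)%E ->
  exists C : R, \forall n \near \oo, `|ln (alpha n)| <= C.
Proof.
rewrite /limn_einf oppe_gt0 => inf sup.
have {inf}[c1 c10 lo] : exists2 c1 : R, 0 < c1 & \forall n \near \oo, c1 <= alpha n.
  have [|y y0 near_y] := @limn_esup_ltP (fun n => - alpha n) 0%E.
    by apply: le_lt_trans inf; rewrite le_eqVlt; apply/orP; left; apply/eqP; congr limn_esup.
  case: y y0 near_y => [y|//|] /= y0 near_y.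
    exists (- y); first by rewrite oppr_gt0 -lte_fin.
    by near=> n; rewrite lerNl -lee_fin; near: n.
  by exists 1 => //; near=> n; have : ((- alpha n)%:E <= -oo)%E by near: n.
have {sup}[c2 hi] : exists c2 : R, \forall n \near \oo, alpha n <= c2.
  have [y yoo near_y] := @limn_esup_ltP alpha _ sup.
  case: y yoo near_y => [y|//|] /= _ near_y.
    by exists y; near=> n; rewrite -lee_fin; near: n.
  by exists 1; near=> n; have : ((alpha n)%:E <= -oo)%E by near: n.
exists (`|ln c1| + `|ln c2|); near=> n.
have a1 : c1 <= alpha n by near: n.
have a2 : alpha n <= c2 by near: n.
have an0 := alpha_gt0 n.
have l1 : ln c1 <= ln (alpha n) by rewrite ler_ln ?posrE.
have l2 : ln (alpha n) <= ln c2 by rewrite ler_ln ?posrE//; exact: lt_le_trans a2.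
have := ler_norm (ln c2); have := ler_norm (- ln c1); rewrite normrN.
by have := normr_ge0 (ln c1); have := normr_ge0 (ln c2); rewrite ler_norml; lra.
Unshelve. all: by end_near. Qed.

Lemma loglog_infty (K : R) : \forall n \near \oo, K <= loglog R n.
Proof.
near=> n; have en : expR (expR K) <= n%:R by near: n; exact: nbhs_infty_ger.
have n0 : 0 < n%:R :> R by apply: lt_le_trans en; exact: expR_gt0.
have h : expR K <= ln n%:R by rewrite -ler_expR lnK.
have l0 : 0 < ln n%:R :> R by apply: lt_le_trans h; exact: expR_gt0.
by rewrite /loglog -ler_expR lnK.
Unshelve. all: by end_near. Qed.

Section Regime.
Variables (Delta lambda : R).
Hypothesis Delta01 : 0 <= Delta <= 1.
Hypothesis alpha_liminf : (0 < limn_einf (fun n => (alpha n)%:E))%E.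
Hypothesis alpha_limsup : (limn_esup (fun n => (alpha n)%:E) < +oo)%E.
Hypothesis cvg_Delta : Delta_seq alpha n @[n --> \oo] --> Delta.
Hypothesis cvg_lambda : lambda_seq alpha n @[n --> \oo] --> lambda.

Lemma regime_near (eta : R) : 0 < eta -> eta <= 1 / 16 ->
  \forall n \near \oo, exists k,
    [/\ regime 'I_n (edge_prob alpha n) (loglog R n) eta Delta lambda k,
        edge_prob alpha n < 1, loglog R n + 1 <= n%:R * edge_prob alpha n &
        loglog R n <= n%:R].
Proof.
move=> eta0 eta16.
have [C aC] := alpha_bounded alpha_liminf alpha_limsup.
near=> n.
have : 32 / eta ^+ 2 <= loglog R n by near: n; exact: loglog_infty.
have : 8 * C / eta <= loglog R n by near: n; exact: loglog_infty.
have : 10 <= loglog R n by near: n; exact: loglog_infty.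
have lnaC : `|ln (alpha n)| <= C by near: n.
have n2 : 3 <= n%:R :> R by near: n; exact: nbhs_infty_ger.
have n0 : 0 < n%:R :> R by lra.
have an0 := alpha_gt0 n.
set L := loglog R n => L10 CL LB.
have L0 : 0 < L by lra.
have lnn : ln n%:R = expR L :> R.
  rewrite /L /loglog lnK// posrE; apply: contraTT L10; rewrite -leNgt => l0.
  by rewrite -ltNge /L /loglog ln0//; lra.
have nE : n%:R = expR (expR L) :> R by rewrite -lnn lnK.
set m := mean_deg alpha n.
have mE : n%:R * edge_prob alpha n = m by [].
have mL : m = alpha n * expR L.
  by rewrite /m /mean_deg /edge_prob lnn; field; rewrite gt_eqF.
have m0 : 0 < m by rewrite mL mulr_gt0 ?expR_gt0.
have lnm : ln m = ln (alpha n) + L by rewrite mL lnM ?posrE ?expR_gt0// expRK.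
have C8 : C <= eta / 8 * L.
  move: CL; rewrite ler_pdivrMr//; lra.
have eL0 : 0 < eta * L by rewrite mulr_gt0.
have eL16 : eta * L <= L / 16 by have := ler_wpM2r (ltW L0) eta16; lra.
have lnmL : `|ln m - L| <= eta / 8 * L.
  by rewrite lnm addrK; exact: le_trans C8.
have /andP[lm1 lm2] : L / 2 <= ln m <= 2 * L.
  by move: lnmL; rewrite ler_norml => /andP[? ?]; apply/andP; split; lra.
have mgeL : L + 1 <= m.
  rewrite -[m]lnK ?posrE//; apply: (@le_trans _ _ (expR (L / 2))); last by rewrite ler_expR.
  have h : 0 <= L / 2 by lra.
  apply: le_trans (expR_ge_sqr h).
  have : 0 <= (L - 10) * L by apply: mulr_ge0; lra.
  by rewrite expr2; lra.
have mL3 : m * L ^+ 3 <= n%:R.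
  have mp : 0 < m * L ^+ 3 by rewrite mulr_gt0// exprn_gt0.
  rewrite -ler_ln ?posrE// lnn.
  rewrite lnM ?posrE ?exprn_gt0// lnXn// -mulr_natl.
  have h1 : ln L <= L by have := ln_sublinear L0; lra.
  apply: le_trans (expR_ge_sqr (ltW L0)).
  have : 0 <= (L - 10) * L by apply: mulr_ge0; lra.
  by rewrite expr2; lra.
have L20 : 0 < L ^+ 2 by rewrite exprn_gt0.
have L31 : L ^+ 2 * 10 <= L ^+ 3.
  have : 0 <= L ^+ 2 * (L - 10) by apply: mulr_ge0; lra.
  by lra.
have L2n : L ^+ 2 < n%:R.
  apply: lt_le_trans mL3.
  have : 0 <= (m - 1) * L ^+ 3 by rewrite mulr_ge0 ?exprn_ge0//; lra.
  by lra.
have Ln : L <= n%:R.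
  apply: le_trans (ltW L2n); have : 0 <= (L - 1) * L by apply: mulr_ge0; lra.
  by rewrite expr2; lra.
have q1 : edge_prob alpha n < 1.
  rewrite -(ltr_pM2l n0) mulr1 mE.
  have : 0 <= m * (L ^+ 3 - 2).
    apply: mulr_ge0; first by lra.
    have : 0 <= (L - 1) * L by apply: mulr_ge0; lra.
    by move: L31; rewrite expr2; lra.
  by lra.
have lm0 : 0 <= ln m by lra.
have lmn0 : ln m != 0 by rewrite gt_eqF//; lra.
have lnmL' : `|ln m - L| <= eta * L by apply: le_trans lnmL _; lra.
have nL1 : 1 < n%:R / L ^+ 2 by rewrite ltr_pdivlMr// mul1r.
have m1 : 1 < m by lra.
have nL0 : 0 < n%:R / L ^+ 2 by rewrite divr_gt0.
have [dset dlow] := d_star_min m1 nL0.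
(* The exponent is positive because m^j <= 1 < n / L^2 for j <= 0. *)
have [k dk] : exists k : nat, d_star alpha n = k.+1%:Z.
  move: dset; rewrite /d_star_set/= -/m -/L.
  case: (d_star alpha n) => [[|k]|j] h; last 2 first.
  - by exists k.
  - have : m ^ Negz j <= 1.
      by rewrite NegzE -exprnN invr_le1 ?unitfE ?exprn_ege1 ?expf_neq0 ?gt_eqF ?exprn_gt0//; lra.
    by lra.
  by move: h; rewrite expr0z; lra.
have Dn : `|Delta - Delta_seq alpha n| <= eta / 4.
  by near: n; move/cvgrPdist_le : cvg_Delta; apply; rewrite divr_gt0.
have lam : `|lambda - lambda_seq alpha n| <= eta.
  by near: n; move/cvgrPdist_le : cvg_lambda; apply.
rewrite /Delta_seq /ell_star -/m in Dn; rewrite /lambda_seq -/m in lam.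
have ck : m ^ d_star alpha n = m ^+ k.+1 by rewrite dk -exprnP.
rewrite ck in lam; rewrite dk in Dn.
(* As ell_n^* ln m = ln n, this is Delta_n ln m. *)
have lnc : ln (m ^+ k.+1 / n%:R) = (k.+1%:~R - ln n%:R / ln m) * ln m.
  rewrite ln_div ?posrE ?exprn_gt0// lnXn// mulrBl divfK//.
  by rewrite -[ln m *+ _]mulr_natl.
exists k; rewrite mE; split=> //.
split=> //; rewrite ?card_ord ?mE//.
- by rewrite -(pmulr_rgt0 _ n0) mE.
- by rewrite lnc; apply: dist_mul_le => //; rewrite lm0.
- by rewrite distrC.
- rewrite ler_pdivrMr// mulrAC ler_pdivlMr// mul1r -ler_pdivrMr//.
  by rewrite -ck; exact: dset.
(* Minimality of d_n^* = k + 1. *)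
- rewrite leNgt; apply/negP => mk.
  have : d_star_set alpha n k%:Z by rewrite /d_star_set/= -exprnP ltW.
  by move=> /dlow; rewrite dk lez_nat ltnn.
Unshelve. all: by end_near. Qed.

End Regime.
End Asymptotics.

(** If Delta > 0, then c is of order e^(Delta L) on the logarithmic scale, so e^(-c), and with it
    lambda, is negligible. *)
Lemma regime_lambda_small (R : realType) (V : finType) (r : V)
    (q L eta Delta lambda : R) (k : nat) :
  regime V q L eta Delta lambda k -> 2 * eta <= Delta -> lambda <= 2 * eta.
Proof.
move=> reg De; have [n0 L1 eL _ [eeL _ c0 _ _]] := regime_basic r reg.
case: reg => eta0 eta16 _ _ _; move: c0.
move: (_ ^+ k.+1 / _) => c c0 last lam _ _ _.
have c32 : 32 / eta <= c.
  apply: le_trans eeL _; rewrite -[leRHS]lnK ?posrE// ler_expR.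
  have : 0 <= (Delta - 2 * eta) * L by apply: mulr_ge0; lra.
  by move: last; rewrite ler_norml; lra.
have ce : 32 <= c * eta by rewrite -ler_pdivrMr.
have : expR (- c) <= eta.
  rewrite expRN -[leLHS]mul1r ler_pdivrMr ?expR_gt0//.
  have := ler_wpM2l (ltW eta0) (expR_ge1Dx c); lra.
by move: lam; rewrite ler_norml; lra.
Qed.

(** Each of the six terms is of order 1 / (eta^2 L), by m^k / n <= 1 / L^2, m L^3 <= n and m - 1 >=
    L; the constant is 24 = 17 + 2 + 1 + 2 + 1 + 1. *)
Lemma atypical_prob_le (R : realType) (V : finType) (r : V)
    (q L eta Delta lambda : R) (k : nat) :
  regime V q L eta Delta lambda k -> q < 1 -> L + 1 <= #|V|%:R * q ->
  L <= #|V|%:R ->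
  expect (vpairs V) q (fun E => (~~ typical r q L eta k E)%:R) <=
    24 / (eta ^+ 2 * L).
Proof.
move=> reg q1 mL LV; have [n0 L1 eL _ [_ _ _ m0 _]] := regime_basic r reg.
case: reg => eta0 eta16 _ q0 _ _ _ _ pk sp.
have L0 : 0 < L by lra.
have m2 : 2 <= #|V|%:R * q by lra.
apply: le_trans (expect_atypical r k q0 q1 m2 L0 eta0) _.
have p4 : 4^-1 ^+ #|V| <= L^-1 :> R.
  rewrite exprVn lef_pV2 ?posrE ?exprn_gt0//; apply: le_trans LV _.
  by rewrite -natrX ler_nat ltnW// ltn_expl.
rewrite [(_ * q) ^+ k.+1]exprS; set n := #|V|%:R in n0 m0 pk sp mL *; set m := n * q in m0 pk sp mL *.
set M := m ^+ k in pk *.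
have M0 : 0 <= M by rewrite exprn_ge0// ltW.
pose i := L^-1; have i0 : 0 < i by rewrite invr_gt0.
have iL : i * L = 1 by rewrite mulVf// gt_eqF.
have i1 : i <= 1 by rewrite invf_le1.
have Mn : M / n <= i * i.
  rewrite ler_pdivrMr// -invfM mulrC -expr2; exact: pk.
have m1i : (m - 1)^-1 <= i by rewrite lef_pV2 ?posrE//; lra.
pose j := eta^-1; have j0 : 0 < j by rewrite invr_gt0.
have j1 : 1 <= j by rewrite invf_ge1//; lra.
have t3 : m * M / (eta * (n / L ^+ 2)) ^+ 2 <= i * j ^+ 2.
  rewrite ler_pdivrMr; last by rewrite exprn_gt0// mulr_gt0 ?divr_gt0 ?exprn_gt0.
  have -> : i * j ^+ 2 * (eta * (n / L ^+ 2)) ^+ 2 = n / L ^+ 3 * (n / L ^+ 2).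
    by rewrite /i /j; field; rewrite !gt_eqF.
  apply: ler_pM => //; first exact: ltW.
  by rewrite ler_pdivlMr ?exprn_gt0.
have -> : 24 / (eta ^+ 2 * L) = 24 * (i * j ^+ 2).
  by rewrite /i /j; field; rewrite !gt_eqF.
have -> : ((m - 1)^-1 + 16 * (M / n)) / eta ^+ 2 = ((m - 1)^-1 + 16 * (M / n)) * j ^+ 2.
  by rewrite exprVn.
rewrite -/i -/j in p4 *; move: (_ ^+ #|V|) p4 => P4 p4.
move: (m * M / _) t3 => T3 t3; move: (M / n) Mn => Q Mn; move: (m - 1)^-1 m1i => U m1i.
have j2 : 0 <= j ^+ 2 by rewrite sqr_ge0.
have ii : i * i <= i by rewrite ler_piMl// ltW.
have jj : j <= j ^+ 2 by rewrite expr2 ler_peMl// ltW.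
have h1 : (U + 16 * Q) * j ^+ 2 <= 17 * i * j ^+ 2 by rewrite ler_wpM2r//; lra.
have h2 : 2 * Q * j <= 2 * i * j ^+ 2.
  apply: (@le_trans _ _ (2 * i * j)); first by apply: ler_wpM2r; [exact: ltW|lra].
  by apply: ler_wpM2l => //; rewrite mulr_ge0// ltW.
have h3 : i <= i * j ^+ 2.
  by apply: ler_peMr; [exact: ltW|exact: le_trans jj].
by move: h1 h2 h3 t3 p4; lra.
Qed.

Theorem theorem1p9 (R : realType) (alpha : nat -> R)
  (alpha_gt0 : forall n, 0 < alpha n)
  (alpha_liminf : (0 < limn_einf (fun n => (alpha n)%:E))%E)
  (alpha_limsup : (limn_esup (fun n => (alpha n)%:E) < +oo)%E)
  (Delta lambda : R)
  (Delta01 : 0 <= Delta <= 1) (lambda01 : 0 <= lambda <= 1)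
  (cvg_Delta : Delta_seq alpha n @[n --> \oo] --> Delta)
  (cvg_lambda : lambda_seq alpha n @[n --> \oo] --> lambda) :
  exists F : R -> R,
    (forall beta : R, 0 < beta -> {for beta, continuous F}) /\
    (Delta = 1 ->
       lambda = 0 /\ forall beta : R, 0 < beta -> F beta = - (1 / beta)) /\
    (Delta < 1 -> lambda < 1 -> forall beta : R, 0 < beta ->
       (1 - Delta <= beta -> F beta = - ((lambda + Delta) / beta)) /\
       (beta <= 1 - Delta ->
          F beta = (1 - (lambda + Delta)) / (1 - Delta) - 1 / beta)) /\
    (lambda = 1 ->
       Delta = 0 /\ forall beta : R, 0 < beta -> F beta = - (1 / beta)) /\
    (forall beta : R, 0 < beta -> forall eps : R, 0 < eps ->
       gnp_prob (edge_prob alpha n.+1)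
         (fun E : {set {set 'I_n.+1}} => eps < `|free_energy E beta - F beta|)
         @[n --> \oo] --> (0 : R)).
Proof.
(* Shifted by one, as the graphs have n + 1 vertices. *)
have regS eta : 0 < eta -> eta <= 1 / 16 -> \forall n \near \oo, exists k,
    [/\ regime 'I_n.+1 (edge_prob alpha n.+1) (loglog R n.+1) eta Delta lambda k,
        edge_prob alpha n.+1 < 1,
        loglog R n.+1 + 1 <= n.+1%:R * edge_prob alpha n.+1 &
        loglog R n.+1 <= n.+1%:R].
  move=> eta0 eta16.
  have [N _ HN] := regime_near alpha_gt0 Delta01 alpha_liminf alpha_limsup
    cvg_Delta cvg_lambda eta0 eta16.
  by exists N => // n /= Nn; apply: HN; exact: leqW.
(* If Delta > 0, then lambda <= 2 eta for every small eta. *)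
have lD : lambda = 0 \/ Delta = 0.
  have [D0|D0] := eqVneq Delta 0; [by right|left].
  have Dp : 0 < Delta by rewrite lt_neqAle eq_sym D0; case/andP: Delta01.
  apply/eqP; rewrite eq_le; apply/andP; split; last by case/andP: lambda01.
  apply/ler_addgt0Pr => e e0; rewrite add0r.
  pose eta := Num.min (1 / 16) (Num.min (Delta / 2) (e / 2)).
  have eta0 : 0 < eta by rewrite !lt_min !divr_gt0.
  have [e1 e2 e3] : [/\ eta <= 1 / 16, eta <= Delta / 2 & eta <= e / 2].
    by split; rewrite /eta !ge_min lexx ?orbT.
  have [N _ /(_ N (leqnn N))[k [reg _ _ _]]] := regS eta eta0 e1.
  by have := regime_lambda_small ord0 reg; lra.
pose Phi beta : R := lambda + (1 - lambda) * Num.max Delta (1 - beta).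
exists (fun beta => - (Phi beta / beta)); split.
  move=> beta beta0.
  have cid : {for beta, continuous (fun x : R => x)} by exact: cvg_id.
  apply: continuousN; apply: continuousM; last first.
    by apply: continuousV => //; rewrite gt_eqF.
  apply: continuousD; first exact: cst_continuous.
  apply: continuousM; first exact: cst_continuous.
  apply: continuous_max; first exact: cst_continuous.
  by apply: continuousB => //; exact: cst_continuous.
split.
  move=> D1; have l0 : lambda = 0 by case: lD => // D0; move: D1; rewrite D0; lra.
  split=> // beta beta0; rewrite /Phi l0 D1.
  have -> : Num.max 1 (1 - beta) = 1 by apply/max_idPl; lra.
  by congr (- (_ / _)); lra.
split.
  move=> D1 l1 beta beta0; split=> hb; rewrite /Phi.
    have -> : Num.max Delta (1 - beta) = Delta by apply/max_idPl; lra.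
    by congr (- (_ / _)); case: lD => ->; lra.
  (* Since one of lambda and Delta vanishes, 1 - lambda equals (1 - (lambda + Delta)) / (1 -
     Delta). *)
  have -> : Num.max Delta (1 - beta) = 1 - beta by apply/max_idPr; lra.
  have bn0 : beta != 0 by rewrite gt_eqF.
  have D1n0 : 1 - Delta != 0 by rewrite gt_eqF// subr_gt0.
  by case: lD => e; rewrite e ?subr0 in D1n0 *; field; rewrite ?bn0 ?D1n0.
split.
  move=> l1; have D0 : Delta = 0 by case: lD => // l0; move: l1; rewrite l0; lra.
  split=> // beta beta0; rewrite /Phi l1 subrr mul0r addr0.
  by [].
move=> beta beta0 eps eps0.
(* The error (20 + 20 beta) eta n L, divided by beta n L, is then at most eps. *)
pose eta := Num.min (1 / 16) (eps * beta / (20 + 20 * beta)).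
have b20 : 0 < 20 + 20 * beta by lra.
have eta0 : 0 < eta by rewrite lt_min !divr_gt0// mulr_gt0.
have eta16 : eta <= 1 / 16 by rewrite ge_min lexx.
have etae : (20 + 20 * beta) * eta <= eps * beta.
  by rewrite mulrC -ler_pdivlMr// /eta ge_min lexx orbT.
apply/cvgrPdist_le => d d0; near=> n.
have Ld : 24 / (eta ^+ 2 * d) <= loglog R n.+1.
  near: n; have [N _ HN] := loglog_infty (24 / (eta ^+ 2 * d)).
  by exists N => // n /= Nn; apply: HN; exact: leqW.
have [k [reg q1 mL LV]] : exists k,
    [/\ regime 'I_n.+1 (edge_prob alpha n.+1) (loglog R n.+1) eta Delta lambda k,
        edge_prob alpha n.+1 < 1,
        loglog R n.+1 + 1 <= n.+1%:R * edge_prob alpha n.+1 &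
        loglog R n.+1 <= n.+1%:R].
  by near: n; exact: regS.
have q0 : 0 < edge_prob alpha n.+1 by case: reg.
have q0' := ltW q0.
have [n0 L1 _ _ _] := regime_basic ord0 reg; rewrite card_ord in n0.
rewrite sub0r normrN; set p := gnp_prob _ _.
have pE : p = expect (vpairs 'I_n.+1) (edge_prob alpha n.+1)
    (fun E => (eps < `|free_energy E beta - - (Phi beta / beta)|)%R%:R).
  rewrite /p /gnp_prob big_mkcondr/=; apply: eq_bigr => E _.
  by rewrite /subset_weight; case: ifP; rewrite ?mulr1 ?mulr0.
have p0 : 0 <= p.
  by rewrite pE; apply: expect_ge0.
rewrite ger0_norm// pE.
apply: (@le_trans _ _ (expect (vpairs 'I_n.+1) (edge_prob alpha n.+1)
    (fun E => (~~ typical ord0 (edge_prob alpha n.+1) (loglog R n.+1) eta k E)%:R))).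
  apply: ler_expect => // E EU.
  rewrite ler_nat; case: (boolP (typical _ _ _ _ _ _)) => [typ|]; last by case: (_ < _).
  rewrite (_ : (_ < _) = false)//; apply/negbTE; rewrite -leNgt.
  have := log_excess_typical reg typ EU Delta01 lambda01 beta0 lD.
  rewrite card_ord -/(Phi beta).
  have -> : free_energy E beta =
      - (log_excess E ord0 (beta * loglog R n.+1) / (beta * (n.+1%:R * loglog R n.+1))).
    rewrite /free_energy /log_excess /partition_fun /ground_energy.
    by field; rewrite !gt_eqF//; lra.
  move: (log_excess _ _ _) => W.
  set nL := n.+1%:R * loglog R n.+1.
  have nL0 : 0 < nL by rewrite mulr_gt0//; lra.
  have -> : - (W / (beta * nL)) - - (Phi beta / beta) =
      - ((W - Phi beta * nL) / (beta * nL)).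
    by field; rewrite !gt_eqF.
  have bnL : 0 < beta * nL by rewrite mulr_gt0.
  rewrite normrN normrM [`|_^-1|]gtr0_norm ?invr_gt0// => h.
  rewrite ler_pdivrMr//; apply: le_trans h _; rewrite [leRHS]mulrA -/nL.
  by rewrite ler_wpM2r// ltW.
apply: le_trans (atypical_prob_le ord0 reg q1 _ _) _; rewrite ?card_ord//.
have e20 : 0 < eta ^+ 2 by rewrite exprn_gt0.
rewrite ler_pdivrMr ?mulr_gt0//; last by lra.
by move: Ld; rewrite ler_pdivrMr ?mulr_gt0//; lra.
Unshelve. all: by end_near. Qed.
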